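(* Let $S$ and $T$ be semigroups with local units. Then the following are equivalent. (1) $S$ and $T$ are Morita equivalent. (2) The categories $C(S)$ and $C(T)$ (the Cauchy completions of $S$ and $T$) are equivalent. (3) $S$ and $T$ have a joint enlargement, which can be chosen to be regular if $S$ and $T$ are both regular. (4) There is a unitary Morita context $(S,T,P,Q,\langle -,- \rangle,[-,-])$ in which the maps $\langle -,-\rangle$ and $[-,-]$ are surjective.
   Context: A semigroup $S$ has local units if for each $s\in S$ there exist idempotents $e,f\in S$ with $es=s=sf$. It is regular if for each $s\in S$ there is $t\in S$ with $s=sts$ and $t=tst$. $E(S)$ is the set of idempotents of $S$. Acts. A left $S$-act is a set with a left action of $S$; $S$-$\mathbf{Act}$ is the category of left $S$-acts and left $S$-homomorphisms. For a right $S$-act $M$ and a left $S$-act $N$, $M\otimes N$ is the quotient of $M\times N$ by the equivalence relation generated by $(ms,n)\sim(m,sn)$. A left $S$-act $X$ is (left) unitary if $SX=X$. It is closed if the map $\mu_X\colon S\otimes X\to X$, $s\otimes x\mapsto sx$, is bijective. $S$-$\mathbf{FAct}$ is the full subcategory of $S$-$\mathbf{Act}$ of closed left $S$-acts. Right acts are treated dually, and $(S,T)$-biacts are defined in the usual way; a biact is unitary if it is left and right unitary. Morita equivalence. Semigroups $S,T$ with local units are Morita equivalent if the categories $S$-$\mathbf{FAct}$ and $T$-$\mathbf{FAct}$ are equivalent. Cauchy completion. $C(S)=\{(e,s,f)\in E(S)\times S\times E(S): esf=s\}$, regarded as a category whose objects (identities) are $(e,e,e)$, $e\in E(S)$, where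 $(e,s,f)$ is an arrow from $f$ to $e$ and $(e,s,f)(f,t,g)=(e,st,g)$. Enlargements. If $S$ is a subsemigroup of $T$, then $T$ is an enlargement of $S$ if $S=STS$ and $T=TST$. For semigroups $S,T,R$ with local units, $R$ is a joint enlargement of $S$ and $T$ if $R$ is an enlargement of subsemigroups $S'$ and $T'$ isomorphic to $S$ and $T$ respectively. Morita contexts. A 6-tuple $(S,T,P,Q,\langle -,-\rangle,[-,-])$, with $S,T$ semigroups, is a Morita context if: (M1) $P$ is an $(S,T)$-biact and $Q$ is a $(T,S)$-biact; (M2) $\langle -,-\rangle\colon P\otimes Q\to S$ is an $(S,S)$-homomorphism and $[-,-]\colon Q\otimes P\to T$ is a $(T,T)$-homomorphism (tensor products over $T$ and $S$ respectively); (M3) for all $p,p'\in P$, $q,q'\in Q$: $\langle p,q\rangle p'=p[q,p']$ and $q\langle p,q'\rangle=[q,p]q'$. It is unitary if $S$ and $T$ have local units, $P$ and $Q$ are closed as left acts, and the biacts $P$ and $Q$ are unitary. *)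

(* Defs.v *)
From HB Require Import structures.
From mathcomp Require Import all_boot monoid generic_quotient.
From mathcomp Require Import boolp classical_sets functions.
From Stdlib Require Import Relation_Operators.

Set Implicit Arguments.
Unset Strict Implicit.
Unset Printing Implicit Defensive.

Local Open Scope classical_set_scope.
Local Open Scope quotient_scope.
Local Open Scope group_scope.

(* Semigroups are MathComp semigroupTypes. Their choiceType structure is no   *)
(* restriction, since boolp provides one on every type. They may be empty,    *)
(* and so may acts.                                                           *)

Section Semigroups.

Definition idem (S : semigroupType) (e : S) : Prop := e * e = e.

Definition has_local_units (S : semigroupType) : Prop :=
  forall s : S, exists e f : S, [/\ idem e, idem f, e * s = s & s = s * f].

Definition regular_semigroup (S : semigroupType) : Prop :=
  forall s : S, exists t : S, s = s * t * s /\ t = t * s * t.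

Definition mulset (S : semigroupType) (A B : set S) : set S :=
  [set a * b | a in A & b in B].

Definition subsemigroup (R : semigroupType) (A : set R) : Prop :=
  forall x y, A x -> A y -> A (x * y).

Definition enlargement (R : semigroupType) (A : set R) : Prop :=
  A = mulset (mulset A [set: R]) A /\
  [set: R] = mulset (mulset [set: R] A) [set: R].

Definition isom_onto (S R : semigroupType) (A : set R) : Prop :=
  exists f : S -> R, {morph f : x y / x * y >-> x * y} /\ set_bij [set: S] A f.

Definition joint_enlargement (S T R : semigroupType) : Prop :=
  has_local_units R /\
  exists S' T' : set R,
    [/\ subsemigroup S', isom_onto S S' & enlargement S'] /\
    [/\ subsemigroup T', isom_onto T T' & enlargement T'].

End Semigroups.

Section Categories.

Record category := Category {
  obj :> Type;
  hom : obj -> obj -> Type;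
  idm : forall a, hom a a;
  comp : forall a b c, hom b c -> hom a b -> hom a c;
  comp1m : forall a b (f : hom a b), comp (idm b) f = f;
  compm1 : forall a b (f : hom a b), comp f (idm a) = f;
  compA : forall a b c d (h : hom c d) (g : hom b c) (f : hom a b),
    comp h (comp g f) = comp (comp h g) f
}.

Record functor (C D : category) := Functor {
  fobj :> C -> D;
  fmap : forall a b, hom a b -> hom (fobj a) (fobj b);
  fmap1 : forall a, fmap (idm a) = idm (fobj a);
  fmapM : forall a b c (g : hom b c) (f : hom a b),
    fmap (comp g f) = comp (fmap g) (fmap f)
}.

Definition functor_id (C : category) : functor C C :=
  @Functor C C (fun a => a) (fun _ _ f => f)
    (fun _ => erefl) (fun _ _ _ _ _ => erefl).

Definition functor_comp (C D E : category) (G : functor D E) (F : functor C D) :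
  functor C E.
Proof.
refine (@Functor C E (fun a => G (F a)) (fun _ _ f => fmap G (fmap F f)) _ _).
- by move=> a; rewrite !fmap1.
- by move=> a b c g f; rewrite !fmapM.
Defined.

Record nat_iso (C D : category) (F G : functor C D) := NatIso {
  ni_hom : forall a, hom (F a) (G a);
  ni_inv : forall a, hom (G a) (F a);
  ni_homK : forall a, comp (ni_inv a) (ni_hom a) = idm (F a);
  ni_invK : forall a, comp (ni_hom a) (ni_inv a) = idm (G a);
  ni_natural : forall a b (f : hom a b),
    comp (ni_hom b) (fmap F f) = comp (fmap G f) (ni_hom a)
}.

Definition cat_equivalent (C D : category) : Prop :=
  exists (F : functor C D) (G : functor D C),
    inhabited (nat_iso (functor_comp G F) (functor_id C)) /\
    inhabited (nat_iso (functor_comp F G) (functor_id D)).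

Definition full_subcategory (C : category) (P : C -> Prop) : category :=
  @Category {a : C | P a} (fun a b => hom (sval a) (sval b))
    (fun a => idm (sval a)) (fun _ _ _ g f => comp g f)
    (fun _ _ f => comp1m f) (fun _ _ f => compm1 f)
    (fun _ _ _ _ h g f => compA h g f).

End Categories.

(* The arrow (e, s, f) of C(S) goes from f to e, so that                      *)
(* hom f e = {s | e s f = s}; its composition is the product of S.            *)
Section Cauchy.
Variable S : semigroupType.

Definition cauchy_obj := {e : S | idem e}.
Definition cauchy_hom (f e : cauchy_obj) :=
  {s : S | sval e * s * sval f = s}.

Lemma cauchy_hom_ext (f e : cauchy_obj) (s t : cauchy_hom f e) :
  sval s = sval t -> s = t.
Proof. exact: eq_sig_hprop (fun _ => @Prop_irrelevance _) _ _. Qed.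

Lemma cauchy_mull (f e : cauchy_obj) (s : cauchy_hom f e) :
  sval e * sval s = sval s.
Proof.
case: e f s => e ee [f ff] [s es] /=.
by rewrite -[in LHS]es !mulgA (ee : _ * _ = _) es.
Qed.

Lemma cauchy_mulr (f e : cauchy_obj) (s : cauchy_hom f e) :
  sval s * sval f = sval s.
Proof.
case: e f s => e ee [f ff] [s es] /=.
by rewrite -[in LHS]es -!mulgA (ff : _ * _ = _) mulgA es.
Qed.

Definition cauchy_id (e : cauchy_obj) : cauchy_hom e e.
Proof. by exists (sval e); rewrite (svalP e : _ * _ = _) (svalP e). Defined.

Definition cauchy_comp (g f e : cauchy_obj)
  (s : cauchy_hom f e) (t : cauchy_hom g f) : cauchy_hom g e.
Proof.
by exists (sval s * sval t); rewrite mulgA cauchy_mull -mulgA cauchy_mulr.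
Defined.

Definition cauchy : category.
Proof.
refine (@Category cauchy_obj cauchy_hom cauchy_id cauchy_comp _ _ _).
- by move=> f e s; apply: cauchy_hom_ext => /=; rewrite cauchy_mull.
- by move=> f e s; apply: cauchy_hom_ext => /=; rewrite cauchy_mulr.
- by move=> g f e d s t u; apply: cauchy_hom_ext => /=; rewrite mulgA.
Defined.

End Cauchy.

Section Acts.

Record lact (S : semigroupType) := LAct {
  lact_sort :> Type;
  lact_op : S -> lact_sort -> lact_sort;
  lact_opA : forall s t x, lact_op (s * t) x = lact_op s (lact_op t x)
}.

Record ract (S : semigroupType) := RAct {
  ract_sort :> Type;
  ract_op : ract_sort -> S -> ract_sort;
  ract_opA : forall x s t, ract_op x (s * t) = ract_op (ract_op x s) t
}.

End Acts.

Reserved Notation "s *:l x" (at level 40).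
Reserved Notation "x *:r t" (at level 40).
Notation "s *:l x" := (lact_op s x) : group_scope.
Notation "x *:r t" := (ract_op x t) : group_scope.

Record biact (S T : semigroupType) := Biact {
  biact_lact :> lact S;
  biact_rop : biact_lact -> T -> biact_lact;
  biact_ropA : forall x s t, biact_rop x (s * t) = biact_rop (biact_rop x s) t;
  biact_lr : forall s x t, biact_rop (s *:l x) t = s *:l (biact_rop x t)
}.

Definition biact_ract (S T : semigroupType) (P : biact S T) : ract T :=
  @RAct T P (@biact_rop S T P) (@biact_ropA S T P).
Coercion biact_ract : biact >-> ract.
Canonical biact_ract.

Section ActCategory.
Variable S : semigroupType.

Definition regular_lact : lact S :=
  @LAct S S (fun s x => s * x) (fun s t x => esym (mulgA s t x)).

Definition regular_biact : biact S S :=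
  @Biact S S regular_lact (fun x s => x * s) mulgA
    (fun s x t => esym (mulgA s x t)).

Record lhom (X Y : lact S) := LHom {
  lhom_fun :> X -> Y;
  lhomP : forall s x, lhom_fun (s *:l x) = s *:l lhom_fun x
}.

Lemma lhom_ext (X Y : lact S) (f g : lhom X Y) : f =1 g -> f = g.
Proof.
case: f g => [f fP] [g gP] /= /funext fg; case: _ / fg in gP *.
by congr LHom; exact: Prop_irrelevance.
Qed.

Definition lhom_id (X : lact S) : lhom X X :=
  @LHom X X (fun x => x) (fun _ _ => erefl).

Definition lhom_comp (X Y Z : lact S) (g : lhom Y Z) (f : lhom X Y) : lhom X Z.
Proof. by exists (fun x => g (f x)) => s x; rewrite !lhomP. Defined.

Definition Act : category.
Proof.
by refine (@Category (lact S) lhom lhom_id lhom_comp _ _ _) => *;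
  apply: lhom_ext.
Defined.

End ActCategory.

Section Tensor.
Variables (S : semigroupType) (M : ract S) (N : lact S).

Inductive tensor_step : M * N -> M * N -> Prop :=
  TensorStep m s n : tensor_step (m *:r s, n) (m, s *:l n).

Definition tensor_rel (x y : {classic M * N}) : bool :=
  `[< clos_refl_sym_trans _ tensor_step x y >].

Lemma tensor_rel_refl : reflexive tensor_rel.
Proof. by move=> x; apply/asboolP; exact: rst_refl. Qed.

Lemma tensor_rel_sym : symmetric tensor_rel.
Proof.
by move=> x y; apply/idP/idP => /asboolP h; apply/asboolP; exact: rst_sym.
Qed.

Lemma tensor_rel_trans : transitive tensor_rel.
Proof.
by move=> y x z /asboolP h /asboolP k; apply/asboolP; exact: rst_trans h k.
Qed.

Canonical tensor_equiv :=
  EquivRel tensor_rel tensor_rel_refl tensor_rel_sym tensor_rel_trans.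

Definition tensor := {eq_quot tensor_equiv}.

Definition tens (m : M) (n : N) : tensor :=
  \pi_tensor ((m, n) : {classic M * N}).

Lemma tensP m n m' n' : tens m n = tens m' n' <->
  clos_refl_sym_trans _ tensor_step (m, n) (m', n').
Proof. by split=> [/eqmodP/asboolP | h]; last exact/eqmodP/asboolP. Qed.

Lemma tens_mid m s n : tens (m *:r s) n = tens m (s *:l n).
Proof. by apply/tensP/rst_step. Qed.

Lemma tens_repr (z : tensor) : tens (repr z).1 (repr z).2 = z.
Proof. by rewrite /tens -surjective_pairing reprK. Qed.

(* Extension to the tensor product of a map M * N -> A; it is meaningful      *)
(* only for balanced maps, see tensor_liftE.                                  *)
Definition tensor_lift (A : Type) (f : M -> N -> A) (z : tensor) : A :=
  f (repr z).1 (repr z).2.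

Lemma tensor_liftE (A : Type) (f : M -> N -> A) :
  (forall m s n, f (m *:r s) n = f m (s *:l n)) ->
  forall m n, tensor_lift f (tens m n) = f m n.
Proof.
move=> fb m n; have /tensP := tens_repr (tens m n); rewrite /tensor_lift.
have h x y : clos_refl_sym_trans _ tensor_step x y -> f x.1 x.2 = f y.1 y.2.
  by elim=> {x y} [_ _ []| | |x y z _ -> _ ->].
by move=> /h.
Qed.

Lemma tensor_ind (Q : tensor -> Prop) :
  (forall m n, Q (tens m n)) -> forall z, Q z.
Proof. by move=> h z; rewrite -(tens_repr z). Qed.

End Tensor.

Section TensorBiact.
Variables (S T U : semigroupType) (P : biact S T) (Q : biact T U).

Definition tensor_lop (s : S) : tensor P Q -> tensor P Q :=
  tensor_lift (fun (p : P) (q : Q) => tens (s *:l p : P) q).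

Definition tensor_rop (z : tensor P Q) (u : U) : tensor P Q :=
  tensor_lift (fun (p : P) (q : Q) => tens p (q *:r u : Q)) z.

Lemma tensor_lopE s (p : P) (q : Q) :
  tensor_lop s (tens p q) = tens (s *:l p : P) q.
Proof.
rewrite /tensor_lop tensor_liftE// => m t n.
by rewrite -tens_mid /= biact_lr.
Qed.

Lemma tensor_ropE u (p : P) (q : Q) :
  tensor_rop (tens p q) u = tens p (q *:r u : Q).
Proof.
rewrite /tensor_rop tensor_liftE// => m t n.
by rewrite tens_mid /= biact_lr.
Qed.

Definition tensor_lact : lact S.
Proof.
refine (@LAct S (tensor P Q) tensor_lop _) => s t.
by elim/tensor_ind => p q; rewrite !tensor_lopE lact_opA.
Defined.

Definition tensor_biact : biact S U.
Proof.
refine (@Biact S U tensor_lact tensor_rop _ _).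
- by elim/tensor_ind => p q s t; rewrite !tensor_ropE ract_opA.
- move=> s z t; elim/tensor_ind: z => p q /=.
  by rewrite !(tensor_ropE, tensor_lopE).
Defined.

End TensorBiact.

Section ClosedActs.
Variable S : semigroupType.

Definition lact_mu (X : lact S) : tensor (regular_biact S) X -> X :=
  tensor_lift (fun (s : regular_biact S) x => (s : S) *:l x).

Lemma lact_muE (X : lact S) (s : S) (x : X) :
  lact_mu (tens (s : regular_biact S) x) = s *:l x.
Proof. by rewrite /lact_mu tensor_liftE// => m t n; exact: lact_opA. Qed.

Definition closed_lact (X : lact S) : Prop := bijective (@lact_mu X).

Definition lunitary (X : lact S) : Prop :=
  [set s *:l x | s in [set: S] & x in [set: X]] = [set: X].

Definition runitary (X : ract S) : Prop :=
  [set x *:r s | x in [set: X] & s in [set: S]] = [set: X].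

Definition FAct : category := @full_subcategory (Act S) closed_lact.

End ClosedActs.

Definition morita_equivalent (S T : semigroupType) : Prop :=
  cat_equivalent (FAct S) (FAct T).

Definition bihom (S T : semigroupType) (P Q : biact S T) (f : P -> Q) : Prop :=
  (forall (s : S) (x : P), f (s *:l x) = s *:l f x) /\
  (forall (x : P) (t : T), f (x *:r t : P) = f x *:r t).

Record morita_context (S T : semigroupType) := MoritaContext {
  mcP : biact S T;
  mcQ : biact T S;
  mcl : tensor_biact mcP mcQ -> regular_biact S;
  mcr : tensor_biact mcQ mcP -> regular_biact T;
  mcl_bihom : bihom mcl;
  mcr_bihom : bihom mcr;
  mc_assocP : forall (p p' : mcP) (q : mcQ),
    (mcl (tens p q) : S) *:l p' = p *:r (mcr (tens q p') : T);
  mc_assocQ : forall (p : mcP) (q q' : mcQ),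
    q *:r (mcl (tens p q') : S) = (mcr (tens q p) : T) *:l q'
}.

Definition unitary_context (S T : semigroupType) (c : morita_context S T) : Prop :=
  [/\ has_local_units S /\ has_local_units T,
      closed_lact (mcP c) /\ closed_lact (mcQ c),
      lunitary (mcP c) /\ runitary (mcP c) &
      lunitary (mcQ c) /\ runitary (mcQ c)].

Definition surjective_map (A B : Type) (f : A -> B) : Prop :=
  set_surj [set: A] [set: B] f.

(* Main.v *)
From HB Require Import structures.
From mathcomp Require Import all_boot monoid.
From mathcomp Require Import boolp classical_sets.
Require Import Defs.

Set Implicit Arguments.
Unset Strict Implicit.
Unset Printing Implicit Defensive.

Local Open Scope classical_set_scope.
Local Open Scope group_scope.

(** The hub is the existence of a surjective pairing, that is, of a surjective
    unitary Morita context with its two maps written as balanced functions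
    ([pairing], [strong]); every condition is shown to be equivalent to it. In a
    strong pairing over semigroups with local units, the acts are automatically
    closed and the two maps out of the tensor products are injective
    ([strong_closed], [strong_pl_inj]): a right unit of an element [p] of [P]
    can be written [[q0, p0]], and [p [q0, p0] = <p, q0> p0] transfers
    computations from tensors to products. Below, [<p, q>] and [[q, p]] denote
    the two pairings.

    From a pairing to a Morita equivalence: [Q (x) _] and [P (x) _] are mutually
    inverse, since [P (x) (Q (x) X)], [S (x) X] and [X] are isomorphic when [X]
    is closed.

    From a Morita equivalence [F], with inverse [G], to a pairing: take [Q = F
    S] and [P = G T], acted upon on the other side through the right
    translations. An element [p] of [P] is a morphism from [S] to [G T], which
    [F] turns into a morphism from [Q] to [T], and its value at [q] is [[q, p]].
    The associativity laws are naturality together with the triangle identities.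
    Surjectivity and unitarity say that some families of morphisms cover their
    targets; equivalences preserve such families because they are the jointly
    epic ones ([jointly_epic_surjective]).

    From a pairing to an equivalence of Cauchy completions: write each
    idempotent [e] of [S] as [<p, q>] with [e p = p], and send it to the
    idempotent [[q, p]].

    From an equivalence [F] of Cauchy completions to a pairing: [P] consists of
    formal products [s (x) x] with [s] in [S e] and [x] in [F(e) T], and [Q] of
    formal products [y (x) s] with [y] in [T F(e)] and [s] in [e S]; full
    faithfulness of [F] allows the inner factors of a product of two of them to
    be evaluated in [S] or in [T]. Formal products are identified when they pair
    equally with everything, and this is enough to turn the associativity laws
    into equalities ([strong_of_weak]).

    From a pairing to a joint enlargement: the disjoint union of [S], [P], [Q]
    and [T] is a semigroup once elements [p0] and [q0] have been chosen to stand
    between factors that are not composable, as in a Rees matrix semigroup. It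
    is an enlargement of [S] and of [T] because the pairings are surjective, and
    it is regular when [S] and [T] are ([strong_regular]).

    From a joint enlargement [R] to a pairing: take the corners [P = S R T] and
    [Q = T R S], with the product of [R]. *)

(** * Adjoint equivalences and jointly epic families *)

(** [nat_iso (functor_comp G F) (functor_id C)] with the composite and identity
    functors unfolded, so that its components compose syntactically. *)
Record unit_iso (C D : category) (F : functor C D) (G : functor D C) := UnitIso {
  ui :> forall X, hom (G (F X)) X;
  uiV : forall X, hom X (G (F X));
  uiK : forall X, comp (uiV X) (ui X) = idm (G (F X));
  uiVK : forall X, comp (ui X) (uiV X) = idm X;
  ui_natural : forall X Y (f : hom X Y),
    comp (ui Y) (fmap G (fmap F f)) = comp f (ui X)
}.

Definition unit_iso_of (C D : category) (F : functor C D) (G : functor D C)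
    (a : nat_iso (functor_comp G F) (functor_id C)) : unit_iso F G :=
  @UnitIso C D F G (ni_hom a) (ni_inv a) (ni_homK a) (ni_invK a) (ni_natural a).

Definition jointly_epic (C : category) (I : Type) (X : I -> C) (Y : C)
    (f : forall i, hom (X i) Y) : Prop :=
  forall Z (g h : hom Y Z), (forall i, comp g (f i) = comp h (f i)) -> g = h.

Section UnitIso.
Variables (C D : category) (F : functor C D) (G : functor D C).
Variable a : unit_iso F G.

Lemma unit_iso_mono X Y (f g : hom Y (G (F X))) :
  comp (a X) f = comp (a X) g -> f = g.
Proof. by move=> fg; rewrite -[f]comp1m -[g]comp1m -!(uiK a) -!compA fg. Qed.

Lemma unit_iso_epi X Y (f g : hom X Y) :
  comp f (a X) = comp g (a X) -> f = g.
Proof. by move=> fg; rewrite -[f]compm1 -[g]compm1 -!(uiVK a) !compA fg. Qed.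

Lemma unit_iso_faithful X Y (f g : hom X Y) : fmap F f = fmap F g -> f = g.
Proof.
by move=> fg; apply: unit_iso_epi; rewrite -!ui_natural fg.
Qed.

(** The preimage of [h] under [F]: see [unit_lift_fmap]. *)
Definition unit_lift X Y (h : hom (F X) (F Y)) : hom X Y :=
  comp (comp (a Y) (fmap G h)) (uiV a X).

Lemma unit_iso_fmap X : fmap G (fmap F (a X)) = a (G (F X)).
Proof. by apply: unit_iso_mono; rewrite ui_natural. Qed.

End UnitIso.

Section Equivalence.
Variables (C D : category) (F : functor C D) (G : functor D C).
Variables (a : unit_iso F G) (b : unit_iso G F).

Lemma unit_lift_fmap X Y (h : hom (F X) (F Y)) : fmap F (unit_lift a h) = h.
Proof.
apply: (unit_iso_faithful b); apply: (unit_iso_mono (a := a)).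
by rewrite ui_natural /unit_lift -compA uiK compm1.
Qed.

(** Two morphisms out of [F Y] that agree on the images [F (f i)] have images
    under [G] that agree, up to the unit, on the [f i]. *)
Lemma equivalence_jointly_epic I (X : I -> C) Y (f : forall i, hom (X i) Y) :
  jointly_epic f -> jointly_epic (fun i => fmap F (f i)).
Proof.
move=> epi Z g h gh; apply: (unit_iso_faithful b).
suff e : comp (fmap G g) (uiV a Y) = comp (fmap G h) (uiV a Y).
  by rewrite -[LHS]compm1 -[RHS]compm1 -!(uiK a) !compA e.
apply: epi => i; apply: (unit_iso_epi (a := a)).
rewrite -!compA -!(ui_natural a) !(compA (uiV a Y)) !uiK !comp1m.
by rewrite -!fmapM gh.
Qed.

End Equivalence.

(** Any equivalence can be made an adjoint one: [G] being fully faithful, its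
    counit can be redefined as the lift along [G] of the unit, which is one of
    the two triangle identities; the other one follows from naturality. *)
Lemma unit_iso_adjoint (C D : category) (F : functor C D) (G : functor D C)
    (a : unit_iso F G) (b : unit_iso G F) : exists b' : unit_iso G F,
  (forall Y, fmap G (b' Y) = a (G Y)) /\ (forall X, fmap F (a X) = b' (F X)).
Proof.
pose c Y := unit_lift b (a (G Y)).
pose cV Y := unit_lift b (uiV a (G Y)).
have cE Y : fmap G (c Y) = a (G Y) by exact: (unit_lift_fmap b a).
have cVE Y : fmap G (cV Y) = uiV a (G Y) by exact: (unit_lift_fmap b a).
have cK Y : comp (cV Y) (c Y) = idm (F (G Y)).
  by apply: (unit_iso_faithful b); rewrite fmapM cE cVE uiK fmap1.
have cVK Y : comp (c Y) (cV Y) = idm Y.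
  by apply: (unit_iso_faithful b); rewrite fmapM cE cVE uiVK fmap1.
have cN X Y (f : hom X Y) : comp (c Y) (fmap F (fmap G f)) = comp f (c X).
  by apply: (unit_iso_faithful b); rewrite fmapM cE [RHS]fmapM cE ui_natural.
exists (UnitIso cK cVK cN); split=> [|X]; first exact: cE.
by apply: (unit_iso_faithful b); rewrite unit_iso_fmap; exact/esym/cE.
Qed.

(** * Tensor products and closed acts *)

Lemma inj_surj_bij (A B : Type) (f : A -> B) :
  injective f -> (forall y, exists x, f x = y) -> bijective f.
Proof.
move=> fi fs; have [g gK] := choice fs.
by exists g => // x; apply: fi.
Qed.

Section ClosedActTheory.
Variable S : semigroupType.

Definition tens_reg (X : lact S) (s : S) (x : X) : tensor (regular_biact S) X :=
  tens (s : regular_biact S) x.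

Lemma closed_lact_inj (X : lact S) (s s' : S) (x x' : X) : closed_lact X ->
  s *:l x = s' *:l x' -> tens_reg s x = tens_reg s' x'.
Proof. by move=> /bij_inj Xi e; apply: Xi; rewrite !lact_muE. Qed.

Lemma closed_lact_surj (X : lact S) : closed_lact X ->
  forall x : X, exists (s : S) (y : X), x = s *:l y.
Proof.
move=> + x; case=> g _ gK; elim/tensor_ind: (g x) (gK x) => s y <-.
by exists s, y; rewrite lact_muE.
Qed.

Lemma closed_lact_intro (X : lact S) :
  (forall (s s' : S) (x x' : X),
    s *:l x = s' *:l x' -> tens_reg s x = tens_reg s' x') ->
  (forall x : X, exists (s : S) (y : X), x = s *:l y) -> closed_lact X.
Proof.
move=> Xi Xs; apply: inj_surj_bij => [|x].
  elim/tensor_ind => s x; elim/tensor_ind => s' x'.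
  by rewrite !lact_muE => /Xi.
by have [s [y ->]] := Xs x; exists (tens_reg s y); rewrite lact_muE.
Qed.

Lemma closed_lact_idem (luS : has_local_units S) (X : lact S) :
  closed_lact X -> forall x : X, exists2 e : S, idem e & e *:l x = x.
Proof.
move=> cX x; have /(_ x) [s [y ->]] := closed_lact_surj cX.
have [e [_ [ee _ es _]]] := luS s; exists e => //.
by rewrite -lact_opA es.
Qed.

(** If [e] fixes [u] on the left and [u] is fixed by [f] on the right, then
    [u (x) f = e (x) u], so all the tensors with product [u] coincide. *)
Lemma regular_closed (luS : has_local_units S) : closed_lact (regular_lact S).
Proof.
have key (s t e : S) : e * (s * t) = s * t ->
    @tens_reg (regular_lact S) s t = @tens_reg (regular_lact S) e (s * t).
  move=> est; have [_ [f [_ _ _ tf]]] := luS t.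
  have bal u v w : @tens_reg (regular_lact S) (u * v) w =
      @tens_reg (regular_lact S) u (v * w).
    exact: (@tens_mid S (regular_biact S) (regular_lact S) u v w).
  by rewrite {1}tf -bal -est bal -!mulgA -tf est.
apply: closed_lact_intro => [s s' t t' /= st | s].
  have [e [_ [_ _ est _]]] := luS (s * t).
  by rewrite (key _ _ e est) st (key s' t' e) // -st.
by have [e [_ [_ _ es _]]] := luS s; exists e, s.
Qed.

End ClosedActTheory.

(** A left act is a biact for the trivial right action, so that [Q (x) X]
    inherits its left action from the tensor product of biacts. *)
Definition right_trivial (S : semigroupType) (X : lact S) : biact S S :=
  @Biact S S X (fun x _ => x) (fun _ _ _ => erefl) (fun _ _ _ => erefl).

Definition tensor_act (S T : semigroupType) (Q : biact T S) (X : lact S) :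
  lact T := tensor_lact Q (right_trivial X).

Definition tensa (S T : semigroupType) (Q : biact T S) (X : lact S)
  (q : Q) (x : X) : tensor_act Q X := @tens S Q X q x.

Section TensorAct.
Variables (S T : semigroupType) (Q : biact T S).

Lemma tensa_mid (X : lact S) (q : Q) (s : S) (x : X) :
  tensa (q *:r s : Q) x = tensa q (s *:l x).
Proof. exact: tens_mid. Qed.

Lemma tensaA (X : lact S) (t : T) (q : Q) (x : X) :
  t *:l tensa q x = tensa (t *:l q : Q) x.
Proof. exact: (@tensor_lopE _ _ _ Q (right_trivial X)). Qed.

Lemma tensa_ind (X : lact S) (A : tensor_act Q X -> Prop) :
  (forall q x, A (tensa q x)) -> forall z, A z.
Proof. exact: tensor_ind. Qed.

Section Map.
Variables (X Y : lact S) (f : lhom X Y).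

Definition tensa_map_fun : tensor_act Q X -> tensor_act Q Y :=
  @tensor_lift S Q X _ (fun q x => tensa q (f x)).

Lemma tensa_map_funE q x : tensa_map_fun (tensa q x) = tensa q (f x).
Proof.
apply: (@tensor_liftE S Q X) => {q}{}x s q.
by rewrite tensa_mid lhomP.
Qed.

Lemma tensa_map_funP t z : tensa_map_fun (t *:l z) = t *:l tensa_map_fun z.
Proof.
by elim/tensa_ind: z => q x; rewrite tensaA !tensa_map_funE tensaA.
Qed.

Definition tensa_map : lhom (tensor_act Q X) (tensor_act Q Y) :=
  LHom tensa_map_funP.
End Map.

End TensorAct.

(** Associativity of the tensor product: when [m] presents [C] as the tensor
    product of [A] and [B], every [c] factors as [m a b], and sending [c (x) x]
    to [a (x) (b (x) x)] is well defined because two factorizations give the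
    same element of [A (x) B]. *)
Lemma tensor_assoc_inj (U V S : semigroupType) (A : biact U V) (B : biact V S)
    (C : biact U S) (m : A -> B -> C) (X : lact S)
    (m_mid : forall a v b, m (a *:r v : A) b = m a (v *:l b))
    (m_r : forall a b s, m a (b *:r s : B) = m a b *:r s)
    (m_surj : forall c, exists a b, c = m a b)
    (m_inj : forall a b a' b', m a b = m a' b' ->
       @tens V A B a b = @tens V A B a' b')
    a b a' b' (x x' : X) :
  tensa (m a b) x = tensa (m a' b') x' ->
  tensa a (tensa b x) = tensa a' (tensa b' x').
Proof.
have fac_ex c : exists ab : A * B, c = m ab.1 ab.2.
  by have [a0 [b0 ->]] := m_surj c; exists (a0, b0).
have [fac facE] := choice fac_ex.
have regroup a1 b1 a2 b2 y : m a1 b1 = m a2 b2 ->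
    tensa a1 (tensa b1 y) = tensa a2 (tensa b2 y) :> tensor_act A (tensor_act B X).
  move=> /m_inj e.
  have tE := @tensor_liftE V A B _ (fun a b => tensa a (@tensa _ _ B X b y)).
  by rewrite -!tE ?e // => a3 v b3; rewrite tensa_mid tensaA.
pose g := @tensor_lift S C X _
  (fun c y => tensa (fac c).1 (tensa (fac c).2 y)).
have gE a1 b1 y : g (tensa (m a1 b1) y) = tensa a1 (tensa b1 y).
  rewrite [LHS](@tensor_liftE S C X) => [|c s z]; first exact/regroup/esym/facE.
  by rewrite -tensa_mid; apply: regroup; rewrite m_r -!facE.
by move=> /(congr1 g); rewrite !gE.
Qed.

(** The case [T (x) Q = Q] of associativity. *)
Lemma tensor_act_closed (S T : semigroupType) (Q : biact T S) (X : lact S) :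
  closed_lact Q -> closed_lact (tensor_act Q X).
Proof.
move=> cQ; apply: closed_lact_intro => [t t'|]; last first.
  elim/tensa_ind => q x; have [t [q' ->]] := closed_lact_surj cQ q.
  by exists t, (tensa q' x); rewrite tensaA.
elim/tensa_ind => q x; elim/tensa_ind => q' x'; rewrite !tensaA.
apply: (@tensor_assoc_inj T T S (regular_biact T) Q Q (fun t q => t *:l q)).
- by move=> a v b; rewrite -lact_opA.
- by move=> a b s; rewrite -biact_lr.
- exact: closed_lact_surj.
- by move=> a b a' b'; exact: closed_lact_inj.
Qed.

(** ** Epimorphic families of closed acts *)

Section ClosedActCategory.
Variables (S : semigroupType) (luS : has_local_units S).

Definition fact (X : lact S) (cX : closed_lact X) : FAct S := exist _ X cX.

Definition jointly_surjective (I : Type) (X : I -> FAct S) (Y : FAct S)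
    (f : forall i, hom (X i) Y) : Prop :=
  forall y : sval Y, exists i x, y = f i x.

Lemma jointly_surjective_epic I (X : I -> FAct S) Y
    (f : forall i, hom (X i) Y) : jointly_surjective f -> jointly_epic f.
Proof.
move=> fs Z g h gh; apply: lhom_ext => y; have [i [x ->]] := fs y.
exact: (congr1 (fun k : lhom (sval (X i)) (sval Z) => k x) (gh i)).
Qed.

(** Classifier of subacts: a subact [A] of [Y] corresponds to the homomorphism
    that sends [y] to the subset of those [s] with [s y] in [A]. *)
Definition subset_lact : lact S.
Proof.
refine (@LAct S (S -> Prop) (fun t I s => I (s * t)) _).
by move=> s t I; apply/funext => u; rewrite mulgA.
Defined.

Definition true_hom (Y : lact S) : lhom Y subset_lact :=
  @LHom S Y subset_lact (fun _ _ => True) (fun _ _ => erefl).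

Definition classifying_hom (Y : lact S) (A : Y -> Prop) : lhom Y subset_lact.
Proof.
refine (@LHom S Y subset_lact (fun y s => A (s *:l y)) _) => t y.
by apply/funext => s /=; rewrite lact_opA.
Defined.

(** The classifying map of the union of the images and the constant map [True]
    agree on the given family. Their common target is not closed, but its
    coreflection [S (x) _] is, so the two maps agree after tensoring with [S],
    hence everywhere. *)
Lemma jointly_epic_surjective I (X : I -> FAct S) Y
    (f : forall i, hom (X i) Y) : jointly_epic f -> jointly_surjective f.
Proof.
case: Y f => Y cY f epi y.
pose A y := exists i x, y = f i x.
have cS : closed_lact (regular_biact S) by exact: regular_closed.
pose Z := fact (tensor_act_closed subset_lact cS).
have [mu' mu'K mu'VK] := cY.
have mu'P s z : mu' (s *:l z) = (s *:l (mu' z : tensor_act (regular_biact S) Y)).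
  apply: (can_inj mu'K); rewrite mu'VK.
  rewrite -{1}[z]mu'VK; elim/tensa_ind: (mu' z) => t x.
  by rewrite tensaA /tensa !lact_muE lact_opA.
pose nu : lhom Y (tensor_act (regular_biact S) Y) :=
  @LHom S Y (tensor_act (regular_biact S) Y) mu' mu'P.
pose g (k : lhom Y subset_lact) : lhom Y (sval Z) :=
  lhom_comp (tensa_map (regular_biact S) k) nu.
have gE k (s : S) (x : Y) :
    g k (s *:l x) = @tensa S S (regular_biact S) _ s (k x).
  rewrite /g /= -(@lact_muE S Y s x) mu'K.
  exact: (@tensa_map_funE S S (regular_biact S) Y subset_lact k s x).
have g12 : g (true_hom Y) = g (classifying_hom A).
  apply: (epi Z) => i; apply: lhom_ext => x.
  have [s [x' ->]] := closed_lact_surj (svalP (X i)) x.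
  have fE : f i (s *:l x') = s *:l (f i x' : Y) by exact: lhomP.
  change (g (true_hom Y) (f i (s *:l x')) =
    g (classifying_hom A) (f i (s *:l x'))).
  rewrite fE !gE; congr tensa; apply/funext => t /=; apply/propext; split=> // _.
  by exists i, (t *:l x'); symmetry; exact: lhomP.
have [e _ ey] := closed_lact_idem luS cY y.
have [s [x yE]] := closed_lact_surj cY y.
have := congr1 (fun k : lhom Y (sval Z) => lact_mu (k (s *:l x))) g12.
rewrite !gE /tensa !lact_muE -!lhomP -yE.
move=> /(congr1 (fun I => I e)) /= eA.
by have : A (e *:l y); [rewrite -eA | rewrite ey].
Qed.

End ClosedActCategory.

(** * Surjective pairings *)

(** A Morita context given by its two balanced pairings. The two associativity
    laws are oriented so that exchanging the two sides is an involution up to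
    conversion, whence the primitive projections. *)
Set Primitive Projections.
Record pairing (S T : semigroupType) := Pairing {
  prgP : biact S T;
  prgQ : biact T S;
  pl : prgP -> prgQ -> S;
  pr : prgQ -> prgP -> T;
  plL : forall (s : S) (p : prgP) (q : prgQ), pl (s *:l p) q = s * pl p q;
  plM : forall (p : prgP) (t : T) (q : prgQ), pl (p *:r t : prgP) q = pl p (t *:l q);
  plR : forall (p : prgP) (q : prgQ) (s : S), pl p (q *:r s : prgQ) = pl p q * s;
  prL : forall (t : T) (q : prgQ) (p : prgP), pr (t *:l q) p = t * pr q p;
  prM : forall (q : prgQ) (s : S) (p : prgP), pr (q *:r s : prgQ) p = pr q (s *:l p);
  prR : forall (q : prgQ) (p : prgP) (t : T), pr q (p *:r t : prgP) = pr q p * t;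
  plA : forall (p : prgP) (q : prgQ) (p' : prgP), pl p q *:l p' = p *:r pr q p';
  prA : forall (q : prgQ) (p : prgP) (q' : prgQ), pr q p *:l q' = q *:r pl p q'
}.
Unset Primitive Projections.
Arguments pl {S T} _ _ _.
Arguments pr {S T} _ _ _.
Arguments plL {S T} _.
Arguments plM {S T} _.
Arguments plR {S T} _.
Arguments plA {S T} _.
Arguments prL {S T} _.
Arguments prM {S T} _.
Arguments prR {S T} _.
Arguments prA {S T} _.

Definition swap (S T : semigroupType) (c : pairing S T) : pairing T S :=
  Pairing (prL c) (prM c) (prR c) (plL c) (plM c) (plR c) (prA c) (plA c).

Definition strong (S T : semigroupType) (c : pairing S T) : Prop :=
  [/\ lunitary (prgP c) /\ runitary (prgP c),
      lunitary (prgQ c) /\ runitary (prgQ c),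
      forall s, exists p q, s = pl c p q &
      forall t, exists q p, t = pr c q p].

Lemma strong_swap (S T : semigroupType) (c : pairing S T) :
  strong c -> strong (swap c).
Proof. by case. Qed.

Lemma lunitaryP (S : semigroupType) (X : lact S) :
  lunitary X <-> forall x : X, exists (s : S) (y : X), x = s *:l y.
Proof.
split=> [uX x | uX]; last first.
  by apply/seteqP; split=> // x _; have [s [y ->]] := uX x; exists s => //; exists y.
by have : [set: X] x by []; rewrite -uX => -[s _ [y _ <-]]; exists s, y.
Qed.

Lemma runitaryP (S : semigroupType) (X : ract S) :
  runitary X <-> forall x : X, exists (y : X) (s : S), x = y *:r s.
Proof.
split=> [uX x | uX]; last first.
  by apply/seteqP; split=> // x _; have [y [s ->]] := uX x; exists y => //; exists s.
by have : [set: X] x by []; rewrite -uX => -[y _ [s _ <-]]; exists y, s.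
Qed.

Lemma lunitary_idem (S : semigroupType) (luS : has_local_units S) (X : lact S) :
  lunitary X -> forall x : X, exists2 e : S, idem e & e *:l x = x.
Proof.
move=> /lunitaryP uX x; have [s [y ->]] := uX x.
by have [e [_ [ee _ es _]]] := luS s; exists e; rewrite // -lact_opA es.
Qed.

Lemma runitary_idem (S : semigroupType) (luS : has_local_units S) (X : ract S) :
  runitary X -> forall x : X, exists2 e : S, idem e & x *:r e = x.
Proof.
move=> /runitaryP uX x; have [y [s ->]] := uX x.
by have [_ [e [_ ee _ es]]] := luS s; exists e; rewrite // -ract_opA -es.
Qed.

Section StrongPairing.
Variables (S T : semigroupType).
Hypotheses (luS : has_local_units S) (luT : has_local_units T).
Variable c : pairing S T.
Hypothesis sc : strong c.
Local Notation P := (prgP c).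
Local Notation Q := (prgQ c).

(** Writing a right unit of [p] as [[q0, p0]] moves [p] across the tensor:
    with [u = s p], [s (x) p = <u, q0> (x) p0 = e (x) <u, q0> p0 = e (x) u]. *)
Lemma strong_tens_reg (s e : S) (p : P) : e *:l (s *:l p) = s *:l p ->
  tens_reg s p = tens_reg e (s *:l p).
Proof.
case: sc => -[_ uP] _ _ surj esp.
have [f _ pf] := runitary_idem luT uP p; have [q0 [p0 fE]] := surj f.
have mid u v (x : P) : tens_reg (u * v) x = tens_reg u (v *:l x).
  exact: (@tens_mid S (regular_biact S) P u v x).
have pE : p = pl c p q0 *:l p0 by rewrite plA -fE pf.
rewrite {1}pE -mid -plL -{1}esp plL mid; congr tens_reg.
by rewrite plL lact_opA -pE.
Qed.

Lemma strong_closed : closed_lact P.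
Proof.
case: sc => -[uP _] _ _ _; apply: closed_lact_intro => [s s' p p' sp | p].
  have [e _ esp] := lunitary_idem luS uP (s *:l p).
  by rewrite (strong_tens_reg esp) (strong_tens_reg (s := s') (e := e)) -sp.
exact: (iffLR (lunitaryP _) uP).
Qed.

(** Here it is [q] that is moved, by writing a right unit of [q] as
    [<p1, q1>]: then [p (x) q = p (x) [q, p1] q1 = <p, q> p1 (x) q1], and the
    left unit [<a, b>] of [<p, q>] moves in the same way. *)
Lemma strong_pl_tens (p a : P) (q b : Q) :
  pl c a b * pl c p q = pl c p q ->
  @tens T P Q p q = @tens T P Q a (b *:r pl c p q : Q).
Proof.
case: sc => _ [_ uQ] surj _ abs.
have [g _ qg] := runitary_idem luS uQ q; have [p1 [q1 gE]] := surj g.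
have mid (x : P) t (y : Q) : @tens T P Q (x *:r t : P) y = @tens T P Q x (t *:l y).
  exact: tens_mid.
have qE : q = pr c q p1 *:l q1 by rewrite prA -gE qg.
rewrite {1}qE -mid -plA -{1}abs lact_opA plA mid; congr tens.
by rewrite prA plL -gE -plR qg.
Qed.

Lemma strong_pl_inj (p p' : P) (q q' : Q) :
  pl c p q = pl c p' q' -> @tens T P Q p q = @tens T P Q p' q'.
Proof.
case: sc => _ _ surj _ e.
have [e0 [_ [_ _ e0s _]]] := luS (pl c p q); have [a [b abE]] := surj e0.
rewrite abE in e0s.
by rewrite (strong_pl_tens e0s) e -strong_pl_tens // -e.
Qed.

End StrongPairing.

(** ** Comparison with Morita contexts *)

Section Context.
Variables S T : semigroupType.
Hypotheses (luS : has_local_units S) (luT : has_local_units T).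

Lemma context_of_strong (d : pairing S T) : strong d ->
  exists c : morita_context S T,
    [/\ unitary_context c, surjective_map (@mcl S T c)
      & surjective_map (@mcr S T c)].
Proof.
move=> sd; case: (sd) => uP uQ sl sr.
pose l : tensor_biact (prgP d) (prgQ d) -> regular_biact S :=
  @tensor_lift T (prgP d) (prgQ d) S (pl d).
pose r : tensor_biact (prgQ d) (prgP d) -> regular_biact T :=
  @tensor_lift S (prgQ d) (prgP d) T (pr d).
have lE p q : l (tens p q) = pl d p q by exact/tensor_liftE/plM.
have rE q p : r (tens q p) = pr d q p by exact/tensor_liftE/prM.
have lh : bihom l.
  split; first by move=> s; elim/tensor_ind => p q; rewrite /= tensor_lopE !lE plL.
  by elim/tensor_ind => p q t; rewrite /= tensor_ropE !lE plR.
have rh : bihom r.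
  split; first by move=> s; elim/tensor_ind => p q; rewrite /= tensor_lopE !rE prL.
  by elim/tensor_ind => p q t; rewrite /= tensor_ropE !rE prR.
have lA p p' q : (l (tens p q) : S) *:l p' = p *:r (r (tens q p') : T).
  by rewrite lE rE plA.
have rA p q q' : q *:r (l (tens p q') : S) = (r (tens q p) : T) *:l q'.
  by rewrite lE rE prA.
exists (MoritaContext lh rh lA rA); split.
- split=> //; split; first exact: strong_closed sd.
  exact: (strong_closed luT luS (strong_swap sd)).
- by move=> s _; have [p [q ->]] := sl s; exists (tens p q); rewrite //= lE.
- by move=> s _; have [p [q ->]] := sr s; exists (tens p q); rewrite //= rE.
Qed.

Lemma strong_of_context (c : morita_context S T) :
  unitary_context c -> surjective_map (@mcl S T c) ->
  surjective_map (@mcr S T c) -> exists d : pairing S T, strong d.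
Proof.
case: c => P Q l r [l1 l2] [r1 r2] lA rA [_ _ /= uP uQ] sl sr.
rewrite /= in l l1 l2 r r1 r2 lA rA sl sr.
pose pl p q : S := l (tens p q); pose pr q p : T := r (tens q p).
have plL (s : S) (p : P) (q : Q) : pl (s *:l p) q = s * pl p q.
  by rewrite /pl -tensor_lopE; exact: l1.
have plR (p : P) (q : Q) (s : S) : pl p (q *:r s : Q) = pl p q * s.
  by rewrite /pl -tensor_ropE; exact: l2.
have plM (p : P) (t : T) (q : Q) : pl (p *:r t : P) q = pl p (t *:l q).
  by rewrite /pl tens_mid.
have prL (t : T) (q : Q) (p : P) : pr (t *:l q) p = t * pr q p.
  by rewrite /pr -tensor_lopE; exact: r1.
have prR (q : Q) (p : P) (t : T) : pr q (p *:r t : P) = pr q p * t.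
  by rewrite /pr -tensor_ropE; exact: r2.
have prM (q : Q) (s : S) (p : P) : pr (q *:r s : Q) p = pr q (s *:l p).
  by rewrite /pr tens_mid.
exists (Pairing plL plM plR prL prM prR (fun p q p' => lA p p' q)
  (fun q p q' => esym (rA p q q'))); split=> //= [s|t].
- by have [z _ <-] := sl s I; elim/tensor_ind: z => p q; exists p, q.
- by have [z _ <-] := sr t I; elim/tensor_ind: z => q p; exists q, p.
Qed.

End Context.

(** * Strong pairings induce equivalences of categories of closed acts *)

Section TensorFunctor.
Variables (S T : semigroupType).
Hypotheses (luS : has_local_units S) (luT : has_local_units T).
Variable c : pairing S T.
Hypothesis sc : strong c.
Local Notation P := (prgP c).
Local Notation Q := (prgQ c).

Definition tensor_fobj (X : FAct S) : FAct T :=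
  fact (tensor_act_closed (sval X) (strong_closed luT luS (strong_swap sc))).

Definition tensor_functor : functor (FAct S) (FAct T).
Proof.
refine (@Functor (FAct S) (FAct T) tensor_fobj (fun _ _ f => tensa_map Q f) _ _).
- move=> X; apply: lhom_ext; elim/tensa_ind => q x; exact: tensa_map_funE.
- move=> X Y Z g f; apply: lhom_ext; elim/tensa_ind => q x /=.
  by rewrite !tensa_map_funE.
Defined.

Variable X : lact S.
Local Notation PQX := (tensor_act P (tensor_act Q X)).

Definition eval_fun : PQX -> X :=
  @tensor_lift T P (tensor_act Q X) X
    (fun p => @tensor_lift S Q X X (fun q x => pl c p q *:l x)).

Lemma eval_funE (p : P) (q : Q) (x : X) :
  eval_fun (tensa p (tensa q x)) = pl c p q *:l x.
Proof.
have inE (p' : P) q' x' : @tensor_lift S Q X X (fun q x => pl c p' q *:l x)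
    (tensa q' x') = pl c p' q' *:l x'.
  by apply: (@tensor_liftE S Q X) => q1 s x1; rewrite -lact_opA -plR.
rewrite [LHS](@tensor_liftE T P (tensor_act Q X)) ?inE // => p1 t.
by elim/tensa_ind => q1 x1; rewrite tensaA !inE plM.
Qed.

Lemma eval_funP (s : S) (z : PQX) : eval_fun (s *:l z) = s *:l eval_fun z.
Proof.
elim/tensa_ind: z => p; elim/tensa_ind => q x.
by rewrite tensaA !eval_funE plL lact_opA.
Qed.

Definition eval_hom : lhom PQX X := LHom eval_funP.

Hypothesis cX : closed_lact X.

(** Injectivity comes in two steps: [X] being closed, an equality of values
    [<p, q> x = <p', q'> x'] lifts to [S (x) X], which is [P (x) (Q (x) X)] by
    injectivity of [<_, _>]. *)
Lemma eval_fun_bij : bijective eval_fun.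
Proof.
case: (sc) => _ _ surj _; apply: inj_surj_bij => [|x].
  elim/tensa_ind => p; elim/tensa_ind => q x.
  elim/tensa_ind => p'; elim/tensa_ind => q' x'.
  rewrite !eval_funE => /(closed_lact_inj cX).
  apply: (@tensor_assoc_inj S T S P Q (regular_biact S) (pl c)).
  - exact: plM.
  - exact: plR.
  - exact: surj.
  - by move=> a b a' b'; exact: (strong_pl_inj luS sc).
have [s [y ->]] := closed_lact_surj cX x; have [p [q ->]] := surj s.
by exists (tensa p (tensa q y)); rewrite eval_funE.
Qed.

Lemma eval_hom_inverse : {g : lhom X PQX | cancel g eval_fun & cancel eval_fun g}.
Proof.
have /cid [g fgK] : exists g, cancel eval_fun g /\ cancel g eval_fun.
  by case: eval_fun_bij => g fK gK; exists g.
case: fgK => fK gK.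
have gP s x : g (s *:l x) = s *:l g x.
  by apply: (can_inj fK); rewrite gK eval_funP gK.
by exists (LHom gP).
Qed.

End TensorFunctor.

Lemma tensor_functor_iso (S T : semigroupType) (luS : has_local_units S)
    (luT : has_local_units T) (c : pairing S T) (sc : strong c)
    (sc' : strong (swap c)) :
  nat_iso (functor_comp (tensor_functor luT luS sc')
                        (tensor_functor luS luT sc))
          (functor_id (FAct S)).
Proof.
pose inv (X : FAct S) := eval_hom_inverse luS sc (svalP X).
refine (@NatIso (FAct S) (FAct S)
  (functor_comp (tensor_functor luT luS sc')
    (tensor_functor luS luT sc)) (functor_id _)
  (fun X => eval_hom c (sval X)) (fun X => s2val (inv X)) _ _ _).
- by move=> X; apply: lhom_ext => z; exact: (s2valP' (inv X) z).
- by move=> X; apply: lhom_ext => z; exact: (s2valP (inv X) z).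
- move=> X Y f; apply: lhom_ext; elim/tensa_ind => p; elim/tensa_ind => q x.
  rewrite /= (@tensa_map_funE T S (prgP c) _ _ (tensa_map (prgQ c) f)) /=.
  by rewrite tensa_map_funE !eval_funE lhomP.
Qed.

Lemma morita_of_strong (S T : semigroupType) (luS : has_local_units S)
    (luT : has_local_units T) (c : pairing S T) :
  strong c -> morita_equivalent S T.
Proof.
move=> sc; have sc' := strong_swap sc.
exists (tensor_functor luS luT sc), (tensor_functor luT luS sc').
split; constructor; first exact: tensor_functor_iso.
(* [swap (swap c)] is convertible to [c] *)
exact: (tensor_functor_iso luT luS sc' sc).
Qed.

(** * Equivalences of categories of closed acts come from strong pairings *)

Definition fapp (S : semigroupType) (X Y : FAct S) (f : hom X Y)
  (x : sval X) : sval Y := (f : lhom (sval X) (sval Y)) x.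

Lemma fappZ (S : semigroupType) (X Y : FAct S) (f : hom X Y) s x :
  fapp f (s *:l x) = s *:l fapp f x.
Proof. exact: lhomP. Qed.

Lemma fapp_comp (S : semigroupType) (X Y Z : FAct S) (g : hom Y Z) (f : hom X Y) x :
  fapp (comp g f) x = fapp g (fapp f x).
Proof. by []. Qed.

Lemma fapp_ext (S : semigroupType) (X Y : FAct S) (f g : hom X Y) :
  fapp f =1 fapp g -> f = g.
Proof. exact: lhom_ext. Qed.

Section Regular.
Variables (S : semigroupType) (luS : has_local_units S).

Definition regular_fact : FAct S := fact (regular_closed luS).

Definition rmul (s : S) : hom regular_fact regular_fact :=
  @LHom S (regular_lact S) (regular_lact S) (fun x => x * s)
    (fun t x => esym (mulgA t x s)).

Definition orbit_map (X : FAct S) (x : sval X) : hom regular_fact X :=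
  @LHom S (regular_lact S) (sval X) (fun s => s *:l x) (fun s t => lact_opA s t x).

Lemma rmulM s t : rmul (s * t) = comp (rmul t) (rmul s).
Proof. by apply: fapp_ext => x; rewrite /fapp /= mulgA. Qed.

Lemma orbit_rmul (X : FAct S) s (x : sval X) :
  comp (orbit_map x) (rmul s) = orbit_map (s *:l x).
Proof. by apply: fapp_ext => t; rewrite /fapp /= lact_opA. Qed.

Lemma comp_orbit (X Y : FAct S) (f : hom X Y) (x : sval X) :
  comp f (orbit_map x) = orbit_map (fapp f x).
Proof. by apply: fapp_ext => s; rewrite fapp_comp /= -fappZ. Qed.

End Regular.

Section ImageBiact.
Variables (S T : semigroupType) (luS : has_local_units S).
Variable F : functor (FAct S) (FAct T).

(** Functoriality carries the right translations of [S] over to [F S]. *)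
Definition image_biact : biact T S.
Proof.
refine (@Biact T S (sval (F (regular_fact luS)))
  (fun q s => fapp (fmap F (rmul luS s)) q) _ _).
- by move=> q s t; rewrite rmulM fmapM.
- by move=> t q s; rewrite fappZ.
Defined.

End ImageBiact.

Section ImagePairing.
Variables (S T : semigroupType).
Hypotheses (luS : has_local_units S) (luT : has_local_units T).
Variables (F : functor (FAct S) (FAct T)) (G : functor (FAct T) (FAct S)).
Variables (a : unit_iso F G) (b : unit_iso G F).
Local Notation P := (image_biact luT G).
Local Notation Q := (image_biact luS F).

Definition orbitP (p : P) : hom (regular_fact luS) (G (regular_fact luT)) :=
  orbit_map luS p.

(** The right translation by [image_pairing q p] is the composite
    [T -> F S -> F (G T) -> T] of the orbit map of [q], the image under [F] of
    the orbit map of [p], and the counit. *)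
Definition image_pairing (q : Q) (p : P) : T :=
  fapp (comp (b (regular_fact luT)) (fmap F (orbitP p))) q.

Lemma image_pairingL (t : T) (q : Q) (p : P) :
  image_pairing (t *:l q) p = t * image_pairing q p.
Proof. by rewrite /image_pairing fappZ. Qed.

Lemma image_pairingM (q : Q) (s : S) (p : P) :
  image_pairing (q *:r s : Q) p = image_pairing q (s *:l p).
Proof.
rewrite /image_pairing /orbitP -orbit_rmul fmapM.
by rewrite compA.
Qed.

Lemma image_pairingR (q : Q) (p : P) (t : T) :
  image_pairing q (p *:r t : P) = image_pairing q p * t.
Proof.
rewrite /image_pairing /orbitP -(comp_orbit luS (fmap G (rmul luT t))).
by rewrite fmapM compA ui_natural -compA.
Qed.

(** The orbit maps of the elements of [G T] cover [G T], hence are jointly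
    epic, and so are their images under [F] followed by the counit. *)
Lemma image_pairing_surj (t : T) : exists q p, t = image_pairing q p.
Proof.
have cover : jointly_surjective orbitP.
  move=> p; have [s [p' ->]] := closed_lact_surj (svalP (G (regular_fact luT))) p.
  by exists p', s.
have epi : jointly_epic (fun p => comp (b (regular_fact luT)) (fmap F (orbitP p))).
  move=> Z g h gh; apply: (unit_iso_epi (a := b)).
  apply: (equivalence_jointly_epic a b (jointly_surjective_epic cover)) => p.
  by rewrite -!compA gh.
have [p [q e]] := jointly_epic_surjective luT epi t.
by exists q, p.
Qed.

Lemma image_lunitary : lunitary Q.
Proof. by apply/lunitaryP; apply: closed_lact_surj; exact: svalP. Qed.

(** As [s] varies, the right translations cover [S], because of its local
    units; so their images under [F] cover [F S]. *)
Lemma image_runitary : runitary Q.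
Proof.
have cover : jointly_surjective (rmul luS).
  by move=> s; have [_ [f [_ _ _ sf]]] := luS s; exists f, s.
have epi := equivalence_jointly_epic a b (jointly_surjective_epic cover).
apply/runitaryP => q.
by have [s [q' ->]] := jointly_epic_surjective luT epi q; exists q', s.
Qed.

End ImagePairing.

(** Both sides are values at [p] of morphisms out of [G T]: the left one is
    [orbit p' o a o G (orbit q)] and the right one [G (b o F (orbit p') o orbit q)],
    which naturality of [a] and the triangle identity identify. *)
Lemma image_pairingA (S T : semigroupType)
    (luS : has_local_units S) (luT : has_local_units T)
    (F : functor (FAct S) (FAct T)) (G : functor (FAct T) (FAct S))
    (a : unit_iso F G) (b : unit_iso G F)
    (tri : forall Y, fmap G (b Y) = a (G Y))
    (p p' : image_biact luT G) (q : image_biact luS F) :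
  image_pairing a p q *:l p' =
  p *:r image_pairing b q p'.
Proof.
have rE : rmul luT (image_pairing b q p') =
    comp (comp (b _) (fmap F (orbitP luS p'))) (orbitP luT q).
  by apply: fapp_ext => t; rewrite fapp_comp /orbitP fappZ.
rewrite /= rE !fmapM tri.
rewrite -[LHS]/(fapp (comp (orbitP luS p') (comp (a _) (fmap G (orbitP luT q)))) p).
by rewrite compA -ui_natural.
Qed.

Lemma strong_of_morita (S T : semigroupType)
    (luS : has_local_units S) (luT : has_local_units T) :
  morita_equivalent S T -> exists c : pairing S T, strong c.
Proof.
case=> F [G [[/unit_iso_of a] [/unit_iso_of b0]]].
have [b [triG triF]] := unit_iso_adjoint a b0.
exists (Pairing (@image_pairingL _ _ luT luS _ _ a) (@image_pairingM _ _ luT luS _ _ a)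
  (@image_pairingR _ _ luT luS _ _ a) (@image_pairingL _ _ luS luT _ _ b)
  (@image_pairingM _ _ luS luT _ _ b) (@image_pairingR _ _ luS luT _ _ b)
  (fun p q p' => image_pairingA triG p p' q)
  (fun q p q' => image_pairingA triF q q' p)).
split=> /=.
- by split; [exact: image_lunitary | exact: (image_runitary luT luS b a)].
- by split; [exact: image_lunitary | exact: (image_runitary luS luT a b)].
- exact: (image_pairing_surj luT luS b a).
- exact: (image_pairing_surj luS luT a b).
Qed.

(** * Strong pairings induce equivalences of Cauchy completions *)

(** A factorization [e = <p, q>] of each idempotent, normalized by [e p = p]
    and [q e = q]; then [[q, p]] is an idempotent of [T] that is isomorphic to
    [e] across the pairing. *)
Record frame (S T : semigroupType) (c : pairing S T) := Frame {
  frp : cauchy_obj S -> prgP c;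
  frq : cauchy_obj S -> prgQ c;
  fr_pl : forall e, pl c (frp e) (frq e) = sval e;
  fr_p : forall e, sval e *:l frp e = frp e;
  fr_q : forall e, frq e *:r sval e = frq e :> prgQ c
}.

Lemma strong_frame (S T : semigroupType) (c : pairing S T) :
  strong c -> inhabited (frame c).
Proof.
case=> _ _ surj _.
have fac (e : cauchy_obj S) : exists pq : prgP c * prgQ c,
    [/\ pl c pq.1 pq.2 = sval e, sval e *:l pq.1 = pq.1
      & pq.2 *:r sval e = pq.2 :> prgQ c].
  have [p [q pqe]] := surj (sval e); have ee := svalP e : _ * _ = _.
  exists (sval e *:l p, q *:r sval e : prgQ c) => /=.
  split; [|by rewrite -lact_opA ee |].
    by rewrite plL plR -pqe !ee.
  by rewrite -[LHS](@ract_opA S (prgQ c)) ee.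
have [f fP] := choice fac.
by constructor; exists (fun e => (f e).1) (fun e => (f e).2) => e; have [] := fP e.
Qed.

Section CauchyFunctor.
Variables (S T : semigroupType) (c : pairing S T) (u : frame c).
Local Notation p_ := (frp u).
Local Notation q_ := (frq u).

Lemma pr_pl (q q' : prgQ c) (p p' : prgP c) :
  pr c q p * pr c q' p' = pr c q (pl c p q' *:l p').
Proof. by rewrite plA prR. Qed.

Lemma frame_idem (e : cauchy_obj S) : idem (pr c (q_ e) (p_ e)).
Proof. by rewrite /idem pr_pl fr_pl fr_p. Qed.

Definition frame_obj (e : cauchy S) : cauchy T := exist _ _ (frame_idem e).

Lemma frame_hom_subproof (f e : cauchy S) (s : hom f e) :
  sval (frame_obj e) * pr c (q_ e) (sval s *:l p_ f) * sval (frame_obj f) =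
  pr c (q_ e) (sval s *:l p_ f).
Proof.
by rewrite /= !pr_pl !plL !fr_pl cauchy_mulr cauchy_mull.
Qed.

Definition frame_hom (f e : cauchy S) (s : hom f e) :
  hom (frame_obj f) (frame_obj e) := exist _ _ (frame_hom_subproof s).

Definition frame_functor : functor (cauchy S) (cauchy T).
Proof.
refine (@Functor (cauchy S) (cauchy T) frame_obj frame_hom _ _).
- by move=> e; apply: cauchy_hom_ext; rewrite /= fr_p.
- move=> g f e s t; apply: cauchy_hom_ext.
  by rewrite /= pr_pl plL fr_pl cauchy_mulr lact_opA.
Defined.

End CauchyFunctor.

Section CauchyIso.
Variables (S T : semigroupType) (c : pairing S T).
Variables (u : frame c) (v : frame (swap c)).
Local Notation GF := (functor_comp (frame_functor v) (frame_functor u)).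

Lemma pl_pr (p p' : prgP c) (q q' : prgQ c) :
  pl c p q * pl c p' q' = pl c p (pr c q p' *:l q').
Proof. by rewrite prA plR. Qed.

Let f (e : cauchy S) : cauchy T := frame_obj u e.
Let p' (e : cauchy S) : prgP c := frq v (f e).
Let q' (e : cauchy S) : prgQ c := frp v (f e).

Let fE e : pr c (q' e) (p' e) = pr c (frq u e) (frp u e).
Proof. exact: (fr_pl v (f e)). Qed.

Let fq' e : pr c (frq u e) (frp u e) *:l q' e = q' e.
Proof. exact: (fr_p v (f e)). Qed.

(** Let [e = <p, q>] by [u], and let [f = [q, p] = [q', p']] by [v]. Then
    [<p, q'>] and [<p', q>] are mutually inverse between [<p', q'>] and [e]; for
    instance [<p, q'> <p', q> = <p, [q', p'] q> = <p, [q, p] q> = <p, q> <p, q>]. *)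
Definition frame_to (e : cauchy S) : hom (GF e) e.
Proof.
exists (pl c (frp u e) (q' e)).
rewrite -plL fr_p -[X in _ * X = _]/(pl c (p' e) (q' e)).
by rewrite pl_pr fE fq'.
Defined.

Definition frame_from (e : cauchy S) : hom e (GF e).
Proof.
exists (pl c (p' e) (frq u e)).
rewrite -[X in X * _ * _ = _]/(pl c (p' e) (q' e)).
by rewrite -mulgA -[X in _ * X]plR fr_q pl_pr fE prA fr_pl fr_q.
Defined.

Lemma frame_iso : nat_iso GF (functor_id (cauchy S)).
Proof.
refine (@NatIso (cauchy S) (cauchy S) GF (functor_id _) frame_to frame_from _ _ _).
- by move=> e; apply: cauchy_hom_ext; rewrite /= pl_pr fq'.
- by move=> e; apply: cauchy_hom_ext; rewrite /= pl_pr fE prA fr_pl fr_q fr_pl.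
- move=> e' e s; apply: cauchy_hom_ext.
  rewrite [LHS]/= [RHS]/=.
  transitivity (pl c (frp u e) (q' e) *
    pl c (p' e) (pr c (frq u e) (sval s *:l frp u e') *:l q' e')) => //.
  rewrite pl_pr -lact_opA fE !pr_pl fr_pl -lact_opA cauchy_mull.
  by rewrite prA plR fr_pl plL mulgA cauchy_mull.
Qed.

End CauchyIso.

Lemma cauchy_of_strong (S T : semigroupType) (c : pairing S T) :
  strong c -> cat_equivalent (cauchy S) (cauchy T).
Proof.
move=> sc; have [u] := strong_frame sc; have [v] := strong_frame (strong_swap sc).
exists (frame_functor u), (frame_functor v); split; constructor.
  exact: frame_iso.
exact: (@frame_iso T S (swap c) v u).
Qed.

(** * Joint enlargements from strong pairings *)

Lemma biact_lrE (S T : semigroupType) (X : biact S T) (s : S) (x : X) (t : T) :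
  s *:l (x *:r t : X) = (s *:l x) *:r t :> X.
Proof. by rewrite /= biact_lr. Qed.

Lemma enlargementP (R : semigroupType) (A : set R) : enlargement A <->
  [/\ forall x, A x -> exists a r b, [/\ A a, A b & x = a * r * b],
      forall a r b, A a -> A b -> A (a * r * b) &
      forall x, exists r a r', A a /\ x = r * a * r'].
Proof.
split=> [[A1 A2] | [A1 A2 A3]].
  split.
  - move=> x; rewrite {1}A1 => -[_ [a Aa [r _ <-]] [b Ab <-]].
    by exists a, r, b.
  - move=> a r b Aa Ab; rewrite A1; exists (a * r); last by exists b.
    by exists a => //; exists r.
  - move=> x; have : [set: R] x by [].
    by rewrite {1}A2 => -[_ [r _ [a Aa <-]] [r' _ <-]]; exists r, a, r'.
split; apply/seteqP; split=> x //.
- move=> /A1 [a [r [b [Aa Ab ->]]]]; exists (a * r); last by exists b.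
  by exists a => //; exists r.
- by move=> [_ [a Aa [r _ <-]] [b Ab <-]]; apply: A2.
- move=> _; have [r [a [r' [Aa ->]]]] := A3 x; exists (r * a); last by exists r'.
  by exists r => //; exists a.
Qed.

Lemma isom_range (S R : semigroupType) (f : S -> R) :
  {morph f : x y / x * y >-> x * y} -> injective f -> isom_onto S (range f).
Proof. by move=> fM fi; exists f; split=> //; split=> // x y _ _; exact: fi. Qed.

Lemma subsemigroup_range (S R : semigroupType) (f : S -> R) :
  {morph f : x y / x * y >-> x * y} -> subsemigroup (range f).
Proof. by move=> fM _ _ [x _ <-] [y _ <-]; exists (x * y). Qed.

Section Linking.
Variables (S T : semigroupType) (c : pairing S T).
Local Notation P := (prgP c).
Local Notation Q := (prgQ c).

(** The two by two matrix units of the context. Without a zero, an element of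
    the first column and one of the second row have no product; the fixed
    [p0] and [q0] are inserted between them to define one, as the sandwich
    matrix of a Rees matrix semigroup does. *)
Inductive linking (p0 : P) (q0 : Q) : Type :=
  LinkS of S | LinkP of P | LinkQ of Q | LinkT of T.

Variables (p0 : P) (q0 : Q).
Local Notation L := (linking p0 q0).
Local Notation LS := (@LinkS p0 q0).
Local Notation LP := (@LinkP p0 q0).
Local Notation LQ := (@LinkQ p0 q0).
Local Notation LT := (@LinkT p0 q0).

Definition linking_mul (x y : L) : L :=
  match x, y with
  | LinkS s, LinkS s' => LS (s * s')
  | LinkS s, LinkP p => LP (s *:l p)
  | LinkS s, LinkQ q => LS (pl c (s *:l p0) q)
  | LinkS s, LinkT t => LP (s *:l (p0 *:r t))
  | LinkP p, LinkS s => LS (pl c p (q0 *:r s))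
  | LinkP p, LinkP p' => LP (pl c p q0 *:l p')
  | LinkP p, LinkQ q => LS (pl c p q)
  | LinkP p, LinkT t => LP (p *:r t)
  | LinkQ q, LinkS s => LQ (q *:r s)
  | LinkQ q, LinkP p => LT (pr c q p)
  | LinkQ q, LinkQ q' => LQ (pr c q p0 *:l q')
  | LinkQ q, LinkT t => LT (pr c q (p0 *:r t))
  | LinkT t, LinkS s => LQ (t *:l (q0 *:r s))
  | LinkT t, LinkP p => LT (pr c (t *:l q0) p)
  | LinkT t, LinkQ q => LQ (t *:l q)
  | LinkT t, LinkT t' => LT (t * t')
  end.

Lemma linking_mulA : associative linking_mul.
Proof.
move=> [s|p|q|t] [s'|p'|q'|t'] [s''|p''|q''|t''] /=;
  by rewrite ?(plL c, plM c, plR c, prL c, prM c, prR c, plA c, prA c,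
    @lact_opA, @ract_opA, @biact_lrE, mulgA).
Qed.

HB.instance Definition _ := gen_eqMixin L.
HB.instance Definition _ := gen_choiceMixin L.
HB.instance Definition _ := isSemigroup.Build L linking_mulA.


Hypotheses (luS : has_local_units S) (luT : has_local_units T).
Hypothesis sc : strong c.

Lemma linking_local_units : has_local_units L.
Proof.
have idS e : idem e -> idem (LS e) by move=> ee; congr LS.
have idT e : idem e -> idem (LT e) by move=> ee; congr LT.
case: sc => -[lP rP] [lQ rQ] _ _ [s|p|q|t].
- have [e [f [ee ff es sf]]] := luS s.
  by exists (LS e), (LS f); split; [exact: idS | exact: idS | congr LS | congr LS].
- have [e ee ep] := lunitary_idem luS lP p; have [f ff pf] := runitary_idem luT rP p.
  by exists (LS e), (LT f); split; [exact: idS | exact: idT | congr LP | congr LP].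
- have [e ee eq] := lunitary_idem luT lQ q; have [f ff qf] := runitary_idem luS rQ q.
  by exists (LT e), (LS f); split; [exact: idT | exact: idS | congr LQ | congr LQ].
- have [e [f [ee ff et tf]]] := luT t.
  by exists (LT e), (LT f); split; [exact: idT | exact: idT | congr LT | congr LT].
Qed.

Lemma linking_enlargementS : enlargement (range LS).
Proof.
case: sc => -[lP rP] [lQ rQ] _ surj; apply/enlargementP; split.
- move=> _ [s _ <-]; have [e [f [_ _ es sf]]] := luS s.
  exists (LS e), (LS s), (LS f); split; [by exists e | by exists f |].
  by congr LS; rewrite es.
- move=> _ [s|p|q|t] _ [a _ <-] [b _ <-]; by eexists.
- move=> [s|p|q|t].
  + have [e [f [_ _ es sf]]] := luS s.
    exists (LS e), (LS s), (LS f); split; first by exists s.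
    by congr LS; rewrite es.
  + have [e _ ep] := lunitary_idem luS lP p.
    exists (LS e), (LS e), (LP p); split; first by exists e.
    by congr LP; rewrite lact_opA !ep.
  + have [e _ qe] := runitary_idem luS rQ q.
    exists (LQ q), (LS e), (LS e); split; first by exists e.
    by congr LQ; rewrite !qe.
  + have [q [p ->]] := surj t; have [e _ qe] := runitary_idem luS rQ q.
    exists (LQ q), (LS e), (LP p); split; first by exists e.
    by congr LT; rewrite qe.
Qed.

Lemma linking_enlargementT : enlargement (range LT).
Proof.
case: sc => -[lP rP] [lQ rQ] surj _; apply/enlargementP; split.
- move=> _ [t _ <-]; have [e [f [_ _ et tf]]] := luT t.
  exists (LT e), (LT t), (LT f); split; [by exists e | by exists f |].
  by congr LT; rewrite et.
- move=> _ [s|p|q|t] _ [a _ <-] [b _ <-]; by eexists.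
- move=> [s|p|q|t].
  + have [p [q ->]] := surj s; have [e _ pe] := runitary_idem luT rP p.
    exists (LP p), (LT e), (LQ q); split; first by exists e.
    by congr LS; rewrite pe.
  + have [e _ pe] := runitary_idem luT rP p.
    exists (LP p), (LT e), (LT e); split; first by exists e.
    by congr LP; rewrite !pe.
  + have [e _ eq] := lunitary_idem luT lQ q.
    exists (LT e), (LT e), (LQ q); split; first by exists e.
    by congr LQ; rewrite lact_opA !eq.
  + have [e [f [_ _ et tf]]] := luT t.
    exists (LT e), (LT t), (LT f); split; first by exists t.
    by congr LT; rewrite et.
Qed.

Lemma linking_joint_enlargement : joint_enlargement S T L.
Proof.
split; first exact: linking_local_units.
have LSM : {morph LS : x y / x * y >-> x * y} by [].
have LTM : {morph LT : x y / x * y >-> x * y} by [].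
exists (range LS), (range LT); split; split.
- exact: subsemigroup_range.
- by apply: isom_range => // x y [].
- exact: linking_enlargementS.
- exact: subsemigroup_range.
- by apply: isom_range => // x y [].
- exact: linking_enlargementT.
Qed.

End Linking.

(** With [p = p f] and [f = [q', p']], put [s = <p, q'>]; then [p = s p'], so an
    inverse [t] of [s] gives [<p, q' t> p = s t s p' = p]. *)
Lemma strong_regular (S T : semigroupType) (luT : has_local_units T)
    (c : pairing S T) (sc : strong c) (regS : regular_semigroup S) (p : prgP c) :
  exists q, pl c p q *:l p = p /\ q *:r pl c p q = q :> prgQ c.
Proof.
case: sc => -[_ rP] _ _ surj.
have [f _ pf] := runitary_idem luT rP p; have [q1 [p1 fE]] := surj f.
have pE : p = pl c p q1 *:l p1 by rewrite plA -fE pf.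
have [t [sts _]] := regS (pl c p q1).
pose q : prgQ c := q1 *:r t.
have qp : pl c p q *:l p = p by rewrite {2}pE -lact_opA plR -sts -pE.
exists (q *:r pl c p q : prgQ c); rewrite plR lact_opA !qp; split=> //.
have idg : pl c p q * pl c p q = pl c p q by rewrite -plL qp.
by rewrite -[LHS](@ract_opA S (prgQ c)) !idg.
Qed.

Lemma linking_regular (S T : semigroupType) (luS : has_local_units S)
    (luT : has_local_units T) (c : pairing S T) (sc : strong c)
    (p0 : prgP c) (q0 : prgQ c) :
  regular_semigroup S -> regular_semigroup T -> regular_semigroup (linking p0 q0).
Proof.
move=> rS rT [s|p|q|t].
- by have [t [st ts]] := rS s; exists (LinkS p0 q0 t); split; congr LinkS.
- have [q [qp qq]] := strong_regular luT sc rS p.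
  exists (LinkQ p0 q0 q); split; first by congr LinkP.
  by congr LinkQ; rewrite prA.
- have [p [pq pp]] := strong_regular luS (strong_swap sc) rT q.
  exists (LinkP p0 q0 p); split; first by congr LinkQ.
  by congr LinkP; rewrite plA.
- by have [s [ts st]] := rT t; exists (LinkT p0 q0 s); split; congr LinkT.
Qed.

(** The case in which there are no [p0] and [q0] to insert. *)
Lemma empty_joint_enlargement (S T : semigroupType) :
  (S -> False) -> (T -> False) -> joint_enlargement S T S.
Proof.
move=> S0 T0; split; first by move=> s; case: (S0 s).
have enl : enlargement [set: S] by apply/enlargementP; split=> s; case: (S0 s).
exists [set: S], [set: S]; split; split=> //.
- by exists id; split=> //; split=> // s; case: (S0 s).
- exists (fun t => False_rect _ (T0 t)); split; first by move=> t; case: (T0 t).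
  by split=> // s; case: (S0 s).
Qed.

Lemma joint_enlargement_of_strong (S T : semigroupType) (luS : has_local_units S)
    (luT : has_local_units T) (c : pairing S T) : strong c ->
  exists R : semigroupType, joint_enlargement S T R /\
    (regular_semigroup S -> regular_semigroup T -> regular_semigroup R).
Proof.
move=> sc; case: (sc) => _ _ surjS surjT.
have [[[p0 q0]] | none] := pselect (inhabited (prgP c * prgQ c)).
  exists (linking p0 q0); split; first exact: linking_joint_enlargement.
  exact: linking_regular.
exists S; split=> //; apply: empty_joint_enlargement.
- by move=> s; have [p [q _]] := surjS s; apply: none; split.
- by move=> t; have [q [p _]] := surjT t; apply: none; split.
Qed.

(** * Strong pairings from joint enlargements *)

Section Corner.
Variables (S T R : semigroupType) (f : S -> R) (g : T -> R).
Hypotheses (fM : {morph f : x y / x * y >-> x * y})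
           (gM : {morph g : x y / x * y >-> x * y}).

Definition in_corner (x : R) : Prop := exists s r t, x = f s * r * g t.

Lemma in_cornerL s x : in_corner x -> in_corner (f s * x).
Proof. by move=> [s' [r [t ->]]]; exists (s * s'), r, t; rewrite fM !mulgA. Qed.

Lemma in_cornerR x t : in_corner x -> in_corner (x * g t).
Proof. by move=> [s [r [t' ->]]]; exists s, r, (t' * t); rewrite gM !mulgA. Qed.

Definition corner_lact : lact S.
Proof.
refine (@LAct S {x | in_corner x} (fun s x => exist _ _ (in_cornerL s (svalP x))) _).
by move=> s t x; apply: eq_exist; rewrite /= fM mulgA.
Defined.

(** The [(S, T)]-biact [f(S) R g(T)]. *)
Definition corner : biact S T.
Proof.
refine (@Biact S T corner_lact (fun x t => exist _ _ (in_cornerR t (svalP x))) _ _).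
- by move=> x s t; apply: eq_exist; rewrite /= gM mulgA.
- by move=> s x t; apply: eq_exist; rewrite /= mulgA.
Defined.

Hypotheses (luS : has_local_units S) (luT : has_local_units T).

Lemma corner_lunitary : lunitary corner.
Proof.
apply/lunitaryP => -[x cx]; have [s [r [t xE]]] := cx.
have [e [_ [_ _ es _]]] := luS s; exists e, (exist _ x cx).
by apply: eq_exist; rewrite /= xE !mulgA -fM es.
Qed.

Lemma corner_runitary : runitary corner.
Proof.
apply/runitaryP => -[x cx]; have [s [r [t xE]]] := cx.
have [_ [e [_ _ _ te]]] := luT t; exists (exist _ x cx), e.
by apply: eq_exist; rewrite /= xE -!mulgA -gM -te.
Qed.

End Corner.

Section CornerPairing.
Variables (S T R : semigroupType) (f : S -> R) (g : T -> R).
Hypotheses (fM : {morph f : x y / x * y >-> x * y})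
           (gM : {morph g : x y / x * y >-> x * y}).
Hypothesis fi : injective f.
Hypotheses (luS : has_local_units S) (luT : has_local_units T).
Hypothesis fRf : forall s r s', exists s0, f s0 = f s * r * f s'.
Hypothesis RgR : forall x, exists r t r', x = r * g t * r'.
Local Notation P := (corner fM gM).
Local Notation Q := (corner gM fM).

Lemma corner_mul_mem (p : P) (q : Q) : exists s, f s = sval p * sval q.
Proof.
case: p q => x [s [r [t xE]]] [y [t' [r' [s' yE]]]] /=.
have [s0 s0E] := fRf s (r * g t * (g t' * r')) s'.
by exists s0; rewrite s0E xE yE !mulgA.
Qed.

Definition corner_pairing (p : P) (q : Q) : S := sval (cid (corner_mul_mem p q)).

Lemma corner_pairingE p q : f (corner_pairing p q) = sval p * sval q.
Proof. exact: svalP (cid (corner_mul_mem p q)). Qed.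

Lemma corner_pairingL s (p : P) q :
  corner_pairing (s *:l p) q = s * corner_pairing p q.
Proof. by apply: fi; rewrite fM !corner_pairingE /= mulgA. Qed.

Lemma corner_pairingM (p : P) t (q : Q) :
  corner_pairing (p *:r t : P) q = corner_pairing p (t *:l q).
Proof. by apply: fi; rewrite !corner_pairingE /= mulgA. Qed.

Lemma corner_pairingR p (q : Q) s :
  corner_pairing p (q *:r s : Q) = corner_pairing p q * s.
Proof. by apply: fi; rewrite fM !corner_pairingE /= mulgA. Qed.

(** [R = R g(T) R] gives [f(s) = r g(t) r'], and splitting [t = e1 t] cuts the
    product into an element of [f(S) R g(T)] and one of [g(T) R f(S)]. *)
Lemma corner_pairing_surj s : exists p q, s = corner_pairing p q.
Proof.
have [e [e' [_ _ es se']]] := luS s; have [r [t [r' sE]]] := RgR (f s).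
have [e1 [_ [_ _ e1t _]]] := luT t.
have cp : in_corner f g (f e * r * g e1) by exists e, r, e1.
have cq : in_corner g f (g t * r' * f e') by exists t, r', e'.
exists (exist _ _ cp), (exist _ _ cq); apply: fi; rewrite corner_pairingE /=.
have -> : f e * r * g e1 * (g t * r' * f e') = f e * (r * g (e1 * t) * r') * f e'.
  by rewrite gM !mulgA.
by rewrite e1t -sE -!fM es -se'.
Qed.

End CornerPairing.

Lemma enlargement_isom (S R : semigroupType) (A : set R) :
  isom_onto S A -> enlargement A ->
  exists f : S -> R, [/\ {morph f : x y / x * y >-> x * y}, injective f,
    forall s r s', exists s0, f s0 = f s * r * f s' &
    forall x, exists r s r', x = r * f s * r'].
Proof.
move=> [f [fM [fA finj fsurj]]] /enlargementP [_ A2 A3].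
exists f; split=> //.
- by move=> x y; apply: finj; rewrite in_setT.
- move=> s r s'; have [s0 _ <-] := fsurj _ (A2 _ r _ (fA s I) (fA s' I)).
  by exists s0.
- move=> x; have [r [a [r' [/fsurj [s _ <-] ->]]]] := A3 x.
  by exists r, s, r'.
Qed.

Lemma strong_of_joint_enlargement (S T R : semigroupType)
    (luS : has_local_units S) (luT : has_local_units T) :
  joint_enlargement S T R -> exists c : pairing S T, strong c.
Proof.
move=> [_ [S' [T' [[_ Si Se] [_ Ti Te]]]]].
have [f [fM fi fRf RfR]] := enlargement_isom Si Se.
have [g [gM gi gRg RgR]] := enlargement_isom Ti Te.
pose l := @corner_pairing S T R f g fM gM fRf.
pose r := @corner_pairing T S R g f gM fM gRg.
have lA p q p' : l p q *:l p' = p *:r r q p'.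
  by apply: eq_exist; rewrite /= !corner_pairingE mulgA.
have rA q p q' : r q p *:l q' = q *:r l p q'.
  by apply: eq_exist; rewrite /= !corner_pairingE mulgA.
exists (@Pairing S T (corner fM gM) (corner gM fM) l r
  (corner_pairingL fi fRf) (corner_pairingM fi fRf) (corner_pairingR fi fRf)
  (corner_pairingL gi gRg) (corner_pairingM gi gRg) (corner_pairingR gi gRg) lA rA).
split=> /=.
- by split; [exact: corner_lunitary | exact: corner_runitary].
- by split; [exact: corner_lunitary | exact: corner_runitary].
- exact: corner_pairing_surj.
- exact: corner_pairing_surj.
Qed.

(** * Strong pairings from equivalences of Cauchy completions *)

(** Quotient of a biact by the kernel of [K], as a surjection [pi] with a
    section [rep]. *)
Lemma biact_image (S T : semigroupType) (P : biact S T) (A : Type) (K : P -> A)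
    (KL : forall s p p', K p = K p' -> K (s *:l p) = K (s *:l p'))
    (KR : forall t p p', K p = K p' -> K (p *:r t : P) = K (p' *:r t : P)) :
  exists (P' : biact S T) (pi : P -> P') (rep : P' -> P),
    [/\ forall s p, pi (s *:l p) = s *:l pi p,
        forall p t, pi (p *:r t : P) = pi p *:r t :> P',
        cancel rep pi & forall p p', pi p = pi p' <-> K p = K p'].
Proof.
pose X := {k | exists p, K p = k}.
pose pi p : X := exist _ (K p) (ex_intro _ p erefl).
pose rep (x : X) : P := sval (cid (svalP x)).
have piE p p' : K p = K p' -> pi p = pi p' by move=> e; apply: eq_exist.
have repE x : K (rep x) = sval x by exact: svalP (cid (svalP x)).
have Krep p : K (rep (pi p)) = K p by rewrite repE.
have repK : cancel rep pi by case=> k kP; apply: eq_exist; exact: repE.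
have piL s p : pi (s *:l rep (pi p)) = pi (s *:l p) by exact/piE/KL/Krep.
have piR t p : pi (rep (pi p) *:r t : P) = pi (p *:r t : P) by exact/piE/KR/Krep.
have lA s t (x : X) : pi ((s * t) *:l rep x) = pi (s *:l rep (pi (t *:l rep x))).
  by rewrite piL lact_opA.
have rA (x : X) s t :
    pi (rep x *:r (s * t) : P) = pi (rep (pi (rep x *:r s : P)) *:r t : P).
  by rewrite piR ract_opA.
have lr s (x : X) t : pi (rep (pi (s *:l rep x)) *:r t : P) =
    pi (s *:l rep (pi (rep x *:r t : P))).
  by rewrite piR piL biact_lrE.
exists (@Biact S T (LAct lA) (fun x t => pi (rep x *:r t : P)) rA lr), pi, rep.
split; [by move=> s p; rewrite /= piL | by move=> p t; rewrite /= piR | exact: repK |].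
by move=> p p'; split=> [/(congr1 sval) | /piE].
Qed.

(** Multiplying the associativity laws of a context by a further factor makes
    them equalities in [S] and [T]. These suffice: the mixed laws themselves
    hold once elements of [P], and of [Q], that pair equally with everything
    are identified. *)
Lemma strong_of_weak (S T : semigroupType) (P : biact S T) (Q : biact T S)
    (l : P -> Q -> S) (r : Q -> P -> T)
    (lL : forall (s : S) p q, l (s *:l p) q = s * l p q)
    (lM : forall p (t : T) q, l (p *:r t : P) q = l p (t *:l q))
    (lR : forall p q (s : S), l p (q *:r s : Q) = l p q * s)
    (rL : forall (t : T) q p, r (t *:l q) p = t * r q p)
    (rM : forall q (s : S) p, r (q *:r s : Q) p = r q (s *:l p))
    (rR : forall q p (t : T), r q (p *:r t : P) = r q p * t)
    (lA : forall p q p' q', l p q * l p' q' = l p (r q p' *:l q'))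
    (rA : forall q p q' p', r q p * r q' p' = r q (l p q' *:l p'))
    (uP : lunitary P /\ runitary P) (uQ : lunitary Q /\ runitary Q)
    (l_surj : forall s, exists p q, s = l p q)
    (r_surj : forall t, exists q p, t = r q p) :
  exists c : pairing S T, strong c.
Proof.
pose KP p := (l p, r^~ p); pose KQ q := (l^~ q, r q).
have KPE p p' : KP p = KP p' <-> (forall q, l p q = l p' q /\ r q p = r q p').
  split=> [[e1 e2] q | e].
    by split; [rewrite e1 | exact: (congr1 (fun h => h q) e2)].
  by congr pair; apply/funext => q; have [] := e q.
have KQE q q' : KQ q = KQ q' <-> (forall p, l p q = l p q' /\ r q p = r q' p).
  split=> [[e1 e2] p | e].
    by split; [exact: (congr1 (fun h => h p) e1) | rewrite e2].
  by congr pair; apply/funext => p; have [] := e p.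
have KPl s p p' : KP p = KP p' -> KP (s *:l p) = KP (s *:l p').
  move=> /KPE e; apply/KPE => q.
  by rewrite !lL -!rM; have [-> _] := e q; have [_ ->] := e (q *:r s).
have KPr t p p' : KP p = KP p' -> KP (p *:r t : P) = KP (p' *:r t : P).
  move=> /KPE e; apply/KPE => q.
  by rewrite !rR !lM; have [_ ->] := e q; have [-> _] := e (t *:l q).
have KQl t q q' : KQ q = KQ q' -> KQ (t *:l q) = KQ (t *:l q').
  move=> /KQE e; apply/KQE => p.
  by rewrite !rL -!lM; have [_ ->] := e p; have [-> _] := e (p *:r t).
have KQr s q q' : KQ q = KQ q' -> KQ (q *:r s : Q) = KQ (q' *:r s : Q).
  move=> /KQE e; apply/KQE => p.
  by rewrite !lR !rM; have [-> _] := e p; have [_ ->] := e (s *:l p).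
have [P' [piP [repP [piPL piPR repPK piPE]]]] := biact_image KPl KPr.
have [Q' [piQ [repQ [piQL piQR repQK piQE]]]] := biact_image KQl KQr.
have KrepP p : KP (repP (piP p)) = KP p by apply/piPE; rewrite repPK.
have KrepQ q : KQ (repQ (piQ q)) = KQ q by apply/piQE; rewrite repQK.
pose l' x y := l (repP x) (repQ y); pose r' y x := r (repQ y) (repP x).
have lE p q : l' (piP p) (piQ q) = l p q.
  by have /KPE/(_ (repQ (piQ q)))[e _] := KrepP p; have /KQE/(_ p)[e' _] := KrepQ q;
    rewrite /l' e e'.
have rE p q : r' (piQ q) (piP p) = r q p.
  by have /KPE/(_ (repQ (piQ q)))[_ e] := KrepP p; have /KQE/(_ p)[_ e'] := KrepQ q;
    rewrite /r' e e'.
have indP x : exists p, x = piP p by exists (repP x); rewrite repPK.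
have indQ y : exists q, y = piQ q by exists (repQ y); rewrite repQK.
have l'L (s : S) x y : l' (s *:l x) y = s * l' x y.
  by have [p ->] := indP x; have [q ->] := indQ y; rewrite -piPL !lE lL.
have l'M x (t : T) y : l' (x *:r t : P') y = l' x (t *:l y).
  by have [p ->] := indP x; have [q ->] := indQ y; rewrite -piPR -piQL !lE lM.
have l'R x y (s : S) : l' x (y *:r s : Q') = l' x y * s.
  by have [p ->] := indP x; have [q ->] := indQ y; rewrite -piQR !lE lR.
have r'L (t : T) y x : r' (t *:l y) x = t * r' y x.
  by have [p ->] := indP x; have [q ->] := indQ y; rewrite -piQL !rE rL.
have r'M y (s : S) x : r' (y *:r s : Q') x = r' y (s *:l x).
  by have [p ->] := indP x; have [q ->] := indQ y; rewrite -piQR -piPL !rE rM.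
have r'R y x (t : T) : r' y (x *:r t : P') = r' y x * t.
  by have [p ->] := indP x; have [q ->] := indQ y; rewrite -piPR !rE rR.
have l'A x y x' : l' x y *:l x' = x *:r r' y x' :> P'.
  have [p ->] := indP x; have [q ->] := indQ y; have [p' ->] := indP x'.
  rewrite lE rE -piPL -piPR; apply/piPE/KPE => q'.
  by rewrite lL lM lA rR rA.
have r'A y x y' : r' y x *:l y' = y *:r l' x y' :> Q'.
  have [p ->] := indP x; have [q ->] := indQ y; have [q' ->] := indQ y'.
  rewrite lE rE -piQL -piQR; apply/piQE/KQE => p'.
  by rewrite rL rM rA lR lA.
exists (Pairing l'L l'M l'R r'L r'M r'R l'A r'A); split=> /=.
- case: uP => /lunitaryP uL /runitaryP uR; split.
    apply/lunitaryP => x; have [p ->] := indP x; have [s [p' ->]] := uL p.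
    by exists s, (piP p'); rewrite piPL.
  apply/runitaryP => x; have [p ->] := indP x; have [p' [t ->]] := uR p.
  by exists (piP p'), t; rewrite piPR.
- case: uQ => /lunitaryP uL /runitaryP uR; split.
    apply/lunitaryP => x; have [p ->] := indQ x; have [s [p' ->]] := uL p.
    by exists s, (piQ p'); rewrite piQL.
  apply/runitaryP => x; have [p ->] := indQ x; have [p' [t ->]] := uR p.
  by exists (piQ p'), t; rewrite piQR.
- by move=> s; have [p [q ->]] := l_surj s; exists (piP p), (piQ q); rewrite lE.
- by move=> t; have [q [p ->]] := r_surj t; exists (piQ q), (piP p); rewrite rE.
Qed.

Section CauchyTriples.
Variables (S T : semigroupType).
Hypotheses (luS : has_local_units S) (luT : has_local_units T).
Variables (F : functor (cauchy S) (cauchy T)) (G : functor (cauchy T) (cauchy S)).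
Variables (a : unit_iso F G) (b : unit_iso G F).

Lemma corner_subproof (R : semigroupType) (e e' : cauchy R) (s : R) :
  sval e * (sval e * s * sval e') * sval e' = sval e * s * sval e'.
Proof.
have ee := svalP e : _ * _ = _; have ee' := svalP e' : _ * _ = _.
by rewrite -!mulgA ee' !mulgA ee.
Qed.

Definition corner_hom (R : semigroupType) (e e' : cauchy R) (s : R) : hom e' e :=
  exist _ (sval e * s * sval e') (corner_subproof e e' s).

Lemma corner_homE (R : semigroupType) (e e' : cauchy R) (h : hom e' e) :
  corner_hom e e' (sval h) = h.
Proof. by apply: cauchy_hom_ext; rewrite /= cauchy_mull cauchy_mulr. Qed.

Lemma sval_comp_corner (R : semigroupType) (e e1 e2 e3 : cauchy R)
    (h : hom e1 e) (s : R) (k : hom e3 e2) :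
  sval (comp h (comp (corner_hom e1 e2 s) k)) = sval h * s * sval k.
Proof. by rewrite /= !mulgA cauchy_mulr -!mulgA cauchy_mull. Qed.

(** [F] is a bijection from [e S e'] to [F(e) T F(e')]. The two directions are
    extended to all of [S] and [T], by cutting their arguments down to these
    corners. *)
Definition functor_corner (e e' : cauchy S) (s : S) : T :=
  sval (fmap F (corner_hom e e' s)).

Definition lift_corner (e e' : cauchy S) (t : T) : S :=
  sval (unit_lift a (corner_hom (F e) (F e') t)).

Lemma unit_lift_comp (e e' e'' : cauchy S) (h : hom (F e') (F e))
    (k : hom (F e'') (F e')) :
  unit_lift a (comp h k) = comp (unit_lift a h) (unit_lift a k).
Proof. by apply: (unit_iso_faithful a); rewrite fmapM !(unit_lift_fmap a b). Qed.

Lemma fmap_unit_lift (e e' : cauchy S) (h : hom e' e) :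
  unit_lift a (fmap F h) = h.
Proof. by apply: (unit_iso_faithful a); rewrite (unit_lift_fmap a b). Qed.

Lemma corner_hom3 (R : semigroupType) (e e1 e2 e3 : cauchy R) (h : hom e2 e1) s s' :
  corner_hom e e3 (s * sval h * s') =
  comp (corner_hom e e1 s) (comp h (corner_hom e2 e3 s')).
Proof.
apply: cauchy_hom_ext => /=; rewrite -[in LHS](cauchy_mull h) -[in LHS](cauchy_mulr h).
by rewrite !mulgA.
Qed.

(** Since [F] and its inverse are multiplicative, an inner value of [F] comes
    out of the inverse unchanged; its idempotents are absorbed on both sides. *)
Lemma lift_corner_functor (e e1 e2 e3 : cauchy S) t s t' :
  lift_corner e e3 (t * functor_corner e1 e2 s * t') =
  lift_corner e e1 t * s * lift_corner e2 e3 t'.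
Proof.
rewrite /lift_corner /functor_corner corner_hom3 !unit_lift_comp fmap_unit_lift.
exact: sval_comp_corner.
Qed.

Lemma functor_corner_lift (e e1 e2 e3 : cauchy S) s t s' :
  functor_corner e e3 (s * lift_corner e1 e2 t * s') =
  functor_corner e e1 s * t * functor_corner e2 e3 s'.
Proof.
rewrite /lift_corner /functor_corner corner_hom3 2!fmapM (unit_lift_fmap a b).
exact: sval_comp_corner.
Qed.

Definition triple (U V : semigroupType) : Type := (U * cauchy_obj S * V)%type.

Definition triple_lact (U V : semigroupType) : lact U.
Proof.
refine (@LAct U (triple U V) (fun u x => (u * x.1.1, x.1.2, x.2)) _).
by move=> u u' x; rewrite mulgA.
Defined.

Definition triple_lr (U V : semigroupType) : biact U V.
Proof.
refine (@Biact U V (triple_lact U V) (fun x v => (x.1.1, x.1.2, x.2 * v)) _ _) => //.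
by move=> x v v'; rewrite mulgA.
Defined.

Local Notation P0 := (triple_lr S T).
Local Notation Q0 := (triple_lr T S).

(** [(s, e, x)] stands for [s e (x) F(e) x] in [S e (x) F(e) T], and [(y, e, s)]
    for [y F(e) (x) e s] in [T F(e) (x) e S]. *)
Definition triple_l (p : triple S T) (q : triple T S) : S :=
  p.1.1 * lift_corner p.1.2 q.1.2 (p.2 * q.1.1) * q.2.

Definition triple_r (q : triple T S) (p : triple S T) : T :=
  q.1.1 * functor_corner q.1.2 p.1.2 (q.2 * p.1.1) * p.2.

Lemma triple_lA (p : P0) (q : Q0) (p' : P0) (q' : Q0) :
  triple_l p q * triple_l p' q' = triple_l p (triple_r q p' *:l q').
Proof.
case: p => [[s e] x]; case: q => [[y e1] s1]; case: p' => [[s' e'] x'].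
case: q' => [[y' e1'] s1']; rewrite /triple_l /triple_r /=.
have -> : x * (y * functor_corner e1 e' (s1 * s') * x' * y') =
  (x * y) * functor_corner e1 e' (s1 * s') * (x' * y') by rewrite !mulgA.
by rewrite lift_corner_functor !mulgA.
Qed.

Lemma triple_rA (q : Q0) (p : P0) (q' : Q0) (p' : P0) :
  triple_r q p * triple_r q' p' = triple_r q (triple_l p q' *:l p').
Proof.
case: p => [[s e] x]; case: q => [[y e1] s1]; case: p' => [[s' e'] x'].
case: q' => [[y' e1'] s1']; rewrite /triple_l /triple_r /=.
have -> : s1 * (s * lift_corner e e1' (x * y') * s1' * s') =
  (s1 * s) * lift_corner e e1' (x * y') * (s1' * s') by rewrite !mulgA.
by rewrite functor_corner_lift !mulgA.
Qed.

Lemma functor_corner_id e : functor_corner e e (sval e) = sval (F e).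
Proof. by rewrite /functor_corner (corner_homE (idm e : hom e e)) fmap1. Qed.

Lemma lift_corner_id e : lift_corner e e (sval (F e)) = sval e.
Proof.
rewrite /lift_corner (corner_homE (idm (F e) : hom (F e) (F e))) -fmap1.
by rewrite fmap_unit_lift.
Qed.

Lemma triple_l_surj s : exists p q, s = triple_l p q.
Proof.
have [_ [e [_ ee _ se]]] := luS s; pose e0 : cauchy S := exist _ e ee.
exists (s, e0, sval (F e0)), (sval (F e0), e0, e); rewrite /triple_l /=.
have FeFe := svalP (F e0) : _ * _ = _.
by rewrite FeFe lift_corner_id /= -!se.
Qed.

(** Every idempotent [f] of [T] is isomorphic to some [F(e)], so that it factors
    through [F(e)]. *)
Lemma triple_r_surj t : exists q p, t = triple_r q p.
Proof.
have [f [_ [ff _ ft _]]] := luT t; pose f0 : cauchy T := exist _ f ff.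
have fE : sval (b f0) * sval (uiV b f0) = f by exact: (congr1 sval (uiVK b f0)).
exists (sval (b f0), G f0, sval (G f0)), (sval (G f0), G f0, sval (uiV b f0) * t).
have ee := svalP (G f0) : _ * _ = _.
rewrite /triple_r /= ee functor_corner_id (cauchy_mulr (b f0)).
by rewrite mulgA fE ft.
Qed.

Lemma triple_unitary (U V : semigroupType) :
  has_local_units U -> has_local_units V ->
  lunitary (triple_lr U V) /\ runitary (triple_lr U V).
Proof.
move=> luU luV; split.
  apply/lunitaryP => -[[u e] v]; have [f [_ [_ _ fu _]]] := luU u.
  by exists f, (u, e, v); rewrite /= fu.
apply/runitaryP => -[[u e] v]; have [_ [f [_ _ _ vf]]] := luV v.
by exists (u, e, v), f; rewrite /= -vf.
Qed.

Lemma strong_of_unit_iso : exists c : pairing S T, strong c.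
Proof.
apply: (@strong_of_weak S T P0 Q0 triple_l triple_r).
- by move=> s p q; rewrite /triple_l /= !mulgA.
- by move=> p t q; rewrite /triple_l /= !mulgA.
- by move=> p q s; rewrite /triple_l /= !mulgA.
- by move=> s p q; rewrite /triple_r /= !mulgA.
- by move=> p t q; rewrite /triple_r /= !mulgA.
- by move=> p q s; rewrite /triple_r /= !mulgA.
- exact: triple_lA.
- exact: triple_rA.
- exact: triple_unitary.
- exact: triple_unitary.
- exact: triple_l_surj.
- exact: triple_r_surj.
Qed.

End CauchyTriples.

Lemma strong_of_cauchy (S T : semigroupType) (luS : has_local_units S)
    (luT : has_local_units T) :
  cat_equivalent (cauchy S) (cauchy T) -> exists c : pairing S T, strong c.
Proof.
case=> F [G [[/unit_iso_of a] [/unit_iso_of b]]].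
exact: (strong_of_unit_iso luS luT a b).
Qed.

Theorem theorem1p1 (S T : semigroupType)
    (luS : has_local_units S) (luT : has_local_units T) :
  [<-> morita_equivalent S T;
       cat_equivalent (cauchy S) (cauchy T);
       (exists R : semigroupType, joint_enlargement S T R) /\
       (regular_semigroup S -> regular_semigroup T ->
        exists R : semigroupType,
          joint_enlargement S T R /\ regular_semigroup R);
       exists c : morita_context S T,
         [/\ unitary_context c, surjective_map (@mcl S T c)
           & surjective_map (@mcr S T c)]].
Proof.
split=> [mor|]; last split=> [cau|]; last split=> [[[R jeR] _]|].
- by have [c sc] := strong_of_morita luS luT mor; exact: cauchy_of_strong sc.
- have [c sc] := strong_of_cauchy luS luT cau.
  have [R [jeR regR]] := joint_enlargement_of_strong luS luT sc.
  by split; [exists R | move=> rS rT; exists R; split=> //; exact: regR].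
- have [c sc] := strong_of_joint_enlargement luS luT jeR.
  exact: context_of_strong sc.
- case=> c [uc sl sr]; have [d sd] := strong_of_context uc sl sr.
  exact: morita_of_strong sd.
Qed.
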